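(* Let $k\geq -1$ be an integer and let $\Delta$ be a $k$-decomposable simplicial complex on the vertex set $X=\{x_1,\dots,x_n\}$ with shedding face $\sigma$, meaning that $\sigma\in\Delta$ is a shedding face of $\Delta$ with $\dim(\sigma)\le k$ such that $\Delta\setminus\sigma$ and $\mathrm{lk}(\sigma)$ are $k$-decomposable. Let $R=\mathbb{K}[x_1,\dots,x_n]$. Then (i) $\mathrm{reg}(R/I_{\Delta})=\max\{\mathrm{reg}(R/I_{\Delta\setminus\sigma}),\ \mathrm{reg}(R/I_{\mathrm{lk}(\sigma)})+|\sigma|\}$, (ii) $\mathrm{pd}(R/I_{\Delta})=\max\{\mathrm{pd}(R/I_{\Delta\setminus\sigma}),\ \mathrm{pd}(R/I_{\mathrm{lk}(\sigma)})\}$, where $I_{\Delta\setminus\sigma}$ and $I_{\mathrm{lk}(\sigma)}$ are the Stanley–Reisner ideals of $\Delta\setminus\sigma$ and $\mathrm{lk}(\sigma)$ on the vertex sets $X$ and $X\setminus\sigma$, respectively.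
   Context: $\mathbb{K}$ is a field. A simplicial complex on a finite vertex set $X$ is a set $\Delta$ of subsets of $X$ (faces) closed under taking subsets and with $\{x\}\in\Delta$ for all $x\in X$ (the derived complexes $\Delta\setminus\sigma$ and $\mathrm{lk}(\sigma)$ below are not required to satisfy the latter condition). $\dim(F)=|F|-1$ for a face $F$. For $\sigma\in\Delta$, $$\mathrm{lk}(\sigma)=\{G\in\Delta: G\cap\sigma=\emptyset,\ G\cup\sigma\in\Delta\},\qquad \Delta\setminus\sigma=\{G\in\Delta:\sigma\nsubseteq G\}.$$ A face $\sigma$ of a complex $\Delta$ on vertex set $V$ is a shedding face if every face $\tau$ of $\Delta$ containing $\sigma$ satisfies: for every $v\in\sigma$ there is $w\in V\setminus\tau$ such that $(\tau\cup\{w\})\setminus\{v\}$ is a face of $\Delta$. $\Delta$ is recursively defined to be $k$-decomposable if either $\Delta$ is a simplex (the set of all subsets of some finite set) or else $\Delta$ has a shedding face $\sigma$ with $\dim(\sigma)\le k$ such that both $\Delta\setminus\sigma$ and $\mathrm{lk}(\sigma)$ are $k$-decomposable. The complexes $\{\}$ and $\{\emptyset\}$ are considered $k$-decomposable for all $k\ge -1$. For a complex $\Gamma$ considered on a vertex set $Y\subseteq X$, its Stanley–Reisner ideal on $Y$ is $I_\Gamma=(x^F: F\subseteq Y,\ F\notin\Gamma)$, where $x^F=\prod_{x\in F}x$; here it is regarded as the ideal of $R$ generated by these monomials. So elements of $Y$ that are not vertices of $\Gamma$ contribute variables to $I_\Gamma$. $\mathrm{reg}$ and $\mathrm{pd}$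 denote Castelnuovo–Mumford regularity and projective dimension of finitely generated graded $R$-modules: $\mathrm{reg}(M)=\max\{j-i:\beta_{i,j}(M)\neq 0\}$, $\mathrm{pd}(M)=\max\{i:\beta_{i,j}(M)\neq 0\text{ for some }j\}$, where $\beta_{i,j}(M)=\dim_{\mathbb{K}}\mathrm{Tor}^R_i(M,\mathbb{K})_j$; both are $-\infty$ for the zero module. *)

(* Defs.v *)
From mathcomp Require Import all_boot all_order all_algebra.
From mathcomp Require Import boolp classical_sets.
From mathcomp Require Import mpoly.
(* The notations of constructive_ereal cannot be loaded together with those of
   mpoly; only the type [extended] (= \bar _) and its operations are used. *)
From mathcomp Require Import -(notations) constructive_ereal.

Set Implicit Arguments.
Unset Strict Implicit.
Unset Printing Implicit Defensive.

Import Order.TTheory GRing.Theory Num.Theory.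

Local Open Scope ring_scope.

Section Complexes.
Variable T : finType.
Implicit Types (V F G s : {set T}) (D : {set {set T}}).

Definition is_complex V D : Prop :=
  [/\ forall F, F \in D -> F \subset V,
      forall F G, F \in D -> G \subset F -> G \in D
    & forall x, x \in V -> [set x] \in D].

Definition dimf F : int := #|F|%:Z - 1.

Definition link D s : {set {set T}} :=
  [set G in D | (G :&: s == finset.set0) && (G :|: s \in D)].

Definition face_deletion D s : {set {set T}} :=
  [set G in D | ~~ (s \subset G)].

Definition shedding_face V D s : Prop :=
  s \in D /\
  forall t, t \in D -> s \subset t ->
  forall v, v \in s ->
  exists2 w, w \in V :\: t & (w |: t) :\ v \in D.

(* [decomposable k V D]: D, viewed as a complex on the vertex set V, is
   k-decomposable. The deletion keeps the vertex set V, the link lives on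
   V :\: s. *)
Inductive decomposable (k : int) : {set T} -> {set {set T}} -> Prop :=
| Decomposable_void V : decomposable k V finset.set0
| Decomposable_simplex V F : F \subset V -> decomposable k V (powerset F)
| Decomposable_shedding V D s :
    shedding_face V D s -> dimf s <= k ->
    decomposable k V (face_deletion D s) ->
    decomposable k (V :\: s) (link D s) ->
    decomposable k V D.

End Complexes.

Section StanleyReisner.
Variables (K : fieldType) (n : nat).

Definition set_monomial (F : {set 'I_n}) : {mpoly K[n]} := \prod_(x in F) 'X_x.

(* The Stanley-Reisner ideal of D on Y, as an ideal of the whole ring. *)
Definition SR_ideal (Y : {set 'I_n}) (D : {set {set 'I_n}})
    (p : {mpoly K[n]}) : Prop :=
  exists c : {set 'I_n} -> {mpoly K[n]},
    p = \sum_(F : {set 'I_n} | (F \subset Y) && (F \notin D))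
          c F * set_monomial F.

End StanleyReisner.

Section Betti.
Variables (K : fieldType) (n : nat).
Local Notation R := {mpoly K[n]}.

(* A nonzero homogeneous polynomial has degree d iff all its monomials do; the
   zero polynomial is homogeneous of every degree. *)
Definition homogeneous_of_degree (d : int) (p : R) : Prop :=
  forall m : 'X_{1..n}, m \in msupp p -> (mdeg m)%:Z = d.

(* Graded free resolutions, with finitely generated terms, of R/I for a
   homogeneous ideal I. The term of index i is R^(rk i), its elements being row
   vectors, with a-th basis vector in degree [gdeg i a]; maps act by right
   multiplication. The augmentation F_0 -> R/I is given by a homogeneous lift
   [aug] to R, so that its kernel is { u | I (u *m aug) }. *)
Record graded_free_resolution (I : R -> Prop) := GradedFreeResolution {
  rk : nat -> nat;
  gdeg : forall i, 'I_(rk i) -> int;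
  aug : 'cV[R]_(rk 0);
  diff : forall i, 'M[R]_(rk i.+1, rk i);
  aug_homogeneous : forall a, homogeneous_of_degree (gdeg a) (aug a 0);
  diff_homogeneous : forall i a b,
    homogeneous_of_degree (gdeg a - gdeg b) (diff i a b);
  aug_surjective : forall p : R, exists u : 'rV[R]_(rk 0),
    I (p - (u *m aug) 0 0);
  exact_aug : forall u : 'rV[R]_(rk 0),
    I ((u *m aug) 0 0) <-> exists v : 'rV[R]_(rk 1), u = v *m diff 0;
  exact_diff : forall i (u : 'rV[R]_(rk i.+1)),
    u *m diff i = 0 <-> exists v : 'rV[R]_(rk i.+2), u = v *m diff i.+1
}.

Section Tor.
Variables (I : R -> Prop) (F : graded_free_resolution I).

(* Tensoring with K = R/(x_1, ..., x_n) amounts to taking constant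
   coefficients of the matrices of F. *)
Definition diffK i : 'M[K]_(rk F i.+1, rk F i) :=
  map_mx (mcoeff 0%MM) (diff F i).

(* The row space of [strand i j] is the degree j part of F_i (x) K. *)
Definition strand i (j : int) : 'M[K]_(rk F i) :=
  diag_mx (\row_a (gdeg a == j)%:R).

Definition tor_cycles i (j : int) : 'M[K]_(rk F i) :=
  match i with
  | 0 => strand 0 j
  | i'.+1 => (strand i'.+1 j :&: kermx (diffK i'))%MS
  end.

Definition tor_boundaries i (j : int) : 'M[K]_(rk F i.+1, rk F i) :=
  strand i.+1 j *m diffK i.

(* dim_K H_i(F (x) K)_j; the boundaries are contained in the cycles, so the
   subtraction is not truncated. *)
Definition tor_dim i (j : int) : nat :=
  (\rank (tor_cycles i j) - \rank (tor_boundaries i j))%N.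

End Tor.

(* The Betti number dim_K Tor_i^R(R/I, K)_j, computed from any graded free
   resolution of R/I. *)
Definition betti (I : R -> Prop) (i : nat) (j : int) : nat :=
  xget 0%N (fun b => exists F : graded_free_resolution I, tor_dim F i j = b).

End Betti.

(* Maximum of a set of integers: -oo for the empty set, and (by convention) +oo
   for a set which is not bounded above. *)
Definition is_max (S : int -> Prop) (m : extended int) : Prop :=
  match m with
  | EFin z => S z /\ forall y, S y -> y <= z
  | ENInf => forall y, ~ S y
  | EPInf => False
  end.

Definition max_of (S : int -> Prop) : extended int := xget (EPInf _) (is_max S).

Section Invariants.
Variables (K : fieldType) (n : nat) (I : {mpoly K[n]} -> Prop).

(* Regularity and projective dimension of R/I. *)
Definition reg_quot : extended int :=
  max_of (fun z => exists i j, betti I i j <> 0%N /\ z = j - i%:Z).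

Definition pd_quot : extended int :=
  max_of (fun z => exists i j, betti I i j <> 0%N /\ z = i%:Z).

End Invariants.

(* Main.v *)
Require Import Defs.
From HB Require Import structures.
From mathcomp Require Import all_boot all_order all_algebra.
From mathcomp Require Import boolp ring zify.
From mathcomp Require classical_sets.
From mathcomp Require Import mpoly.
From mathcomp Require Import -(notations) constructive_ereal.
Import Order.TTheory GRing.Theory Num.Theory.
Local Open Scope ring_scope.
Set Implicit Arguments.
Unset Strict Implicit.
Unset Printing Implicit Defensive.

(** The proof compares the two sides of each formula through Hochster's
formula.  Write D_W for the subcomplex of the faces of D inside W.  The Betti
number of R/I_D in homological degree i and internal degree p + i is the sum,
over the sets W of p + i vertices, of the dimensions of the reduced cohomology
groups H^(p-1)(D_W).  Hence the regularity is the largest p, and the projective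
dimension the largest i, for which some such group is nonzero
([betti_hochster]).  Both maxima stay the same when the restrictions D_W are
replaced by the links lk F of faces, with i = n - |F| - p: deleting a vertex
gives a long exact sequence between a complex, its deletion and its link, and
walking along it from a restriction to a link, or back, never lowers p or i
([hochster_to_link], [link_to_hochster]).

For links the shedding face s yields an exact splitting.  Let E be the deletion
of s and L its link.  In a decomposable complex, and in all its links, every
cocycle is cohomologous to one supported on facets ([facet_concentrated_link]).
The shedding condition says that the facets of E are facets of D; so a cocycle
of E supported on facets of E, extended by 0, is a cocycle of D.  The connecting
maps of the long exact sequence of the pair (D, E) therefore vanish, and
H^(p-1)(D) is nonzero if and only if H^(p-1)(E) or H^(p-1-|s|)(L) is
([acyclic_shedding]).  Applied to every link of D this moves p by |s| and keeps
i, which is how |s| enters the formula for the regularity and is absent from the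
one for the projective dimension ([hochster_shedding]).

Hochster's formula is obtained from an explicit finite free resolution of R/I_D
([face_resolution]).  It has one basis element for each pair (F, S) with F a
face and S a set of vertices disjoint from F, of homological degree |S| and
internal degree |F| + |S|; the differential removes a vertex v from S and either
adds it to F or multiplies by - x_v.  Filtered by |F|, it is made of the Koszul
complexes on the variables outside F, whence its exactness ([exact_bd],
[koszul_exact]).  Modulo the variables only the moves of v from S to F remain;
with W the union of F and S fixed, these form the cochain complex of D_W
([bd_cochain]).  Finally, the vanishing of a Betti number can be read off any
resolution, because two graded free resolutions are homotopy equivalent
([tor_nonzero_transfer]). *)

(** * Signs *)

Section Signs.
Variables (R : comNzRingType) (n : nat).
Implicit Types (v u : 'I_n) (S A B : {set 'I_n}).

Definition sg v S : R := (-1) ^+ #|[set u in S | (u < v)%N]|.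

Lemma sg_sq v S : sg v S * sg v S = 1.
Proof. by rewrite /sg -expr2 sqrr_sign. Qed.

Lemma sgU v A B : [disjoint A & B] -> sg v (A :|: B) = sg v A * sg v B.
Proof.
move=> dAB; rewrite /sg -exprD -cardsUI.
rewrite (_ : _ :&: _ = set0); last first.
  apply/setP=> u; rewrite !inE; apply/negP=> /andP[/andP[uA _] /andP[uB _]].
  by have := disjointFr dAB uA; rewrite uB.
rewrite cards0 addn0; congr (_ ^+ _); apply: eq_card => u.
by rewrite !inE andb_orl.
Qed.

Lemma sg1 v u : sg v [set u] = if (u < v)%N then -1 else 1.
Proof.
rewrite /sg; case: ifP => uv.
  rewrite (_ : [set _ in _ | _] = [set u]) ?cards1 ?expr1 //.
  by apply/setP=> w; rewrite !inE; case: eqP => // ->; rewrite uv.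
rewrite (_ : [set _ in _ | _] = set0) ?cards0 //.
by apply/setP=> w; rewrite !inE; case: eqP => // ->; rewrite uv.
Qed.

Lemma sgU1 v u S : u \notin S ->
  sg v (u |: S) = (if (u < v)%N then -1 else 1) * sg v S.
Proof. by move=> uS; rewrite sgU ?sg1 // disjoints1. Qed.

Lemma sgD1 v S : sg v (S :\ v) = sg v S.
Proof.
congr (_ ^+ _); apply: eq_card => u; rewrite !inE.
by case: eqP => //= ->; rewrite ltnn !andbF.
Qed.

Lemma sg_self v S : sg v (v |: S) = sg v S.
Proof.
congr (_ ^+ _); apply: eq_card => u; rewrite !inE.
by case: eqP => //= ->; rewrite ltnn !andbF.
Qed.

Lemma sg_anti v u S : v != u -> v \notin S -> u \notin S ->
  sg v S * sg u (v |: S) = - (sg u S * sg v (u |: S)).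
Proof.
move=> vu vS uS; rewrite !sgU1 //.
have : (v < u)%N || (u < v)%N by rewrite -neq_ltn.
case: ltngtP => // _ _; rewrite ?mulN1r ?mul1r ?mulrN ?opprK mulrC //.
Qed.

(** The common source of all the relations saying that a boundary map squares to
zero.  The terms are paired off by comparing u with v, since an antisymmetric
sum need not vanish by itself in characteristic 2. *)
Lemma sum_antisym (P : {set 'I_n}) (g : 'I_n -> 'I_n -> R) :
  (forall u v, u \in P -> v \in P -> u != v -> g v u = - g u v) ->
  \sum_(v in P) \sum_(u in P | u != v) g v u = 0.
Proof.
move=> gA.
have split_lt v : v \in P -> \sum_(u in P | u != v) g v u =
    \sum_(u in P) (if (v < u)%N then g v u else 0)
    - \sum_(u in P) (if (u < v)%N then g u v else 0).
  move=> vP; rewrite -sumrB [RHS](bigD1 v) //= ltnn subrr add0r.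
  apply: eq_bigr => u /andP[uP uv].
  have : (v < u)%N || (u < v)%N by rewrite -neq_ltn eq_sym.
  by case: ltngtP => // _ _; rewrite ?subr0 // sub0r -gA.
rewrite (eq_bigr _ split_lt) sumrB exchange_big /= subrr //.
Qed.

Lemma sum_sg_antisym (P : {set 'I_n}) S (a : 'I_n -> 'I_n -> R) :
  (forall u v, u \in P -> v \in P -> u != v -> a v u = a u v) ->
  \sum_(v in P | v \notin S) \sum_(u in P | u \notin v |: S)
     sg v S * sg u (v |: S) * a v u = 0.
Proof.
move=> aC; rewrite -[RHS](@sum_antisym (P :\: S)
  (fun v u => sg v S * sg u (v |: S) * a v u)).
  apply: eq_big => v; first by rewrite !inE andbC.
  move=> /andP[vP vS]; apply: eq_bigl => u; rewrite !inE negb_or.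
  by case: (u == v); rewrite ?andbF ?andbT //= andbC.
move=> u v; rewrite !inE => /andP[uS uP] /andP[vS vP] uv.
by rewrite aC // sg_anti 1?eq_sym // mulNr.
Qed.

End Signs.
Arguments sg {R n}.

(** * Cochains on families of sets *)

Section Coboundary.
Variables (K : fieldType) (n : nat).
Local Notation V := {set 'I_n}.
Implicit Types (c b f : V -> K) (F G H W s t : V) (D E L : {set V}) (v w : 'I_n) (p q r : nat).

Definition down_closed D := forall F G, F \in D -> G \subset F -> G \in D.

(** Cochains are functions on all sets of vertices.  To be a cocycle or a
coboundary of a complex is a condition on the faces only, so restricting a
cochain to a subcomplex requires no operation. *)
Definition cob c G : K := \sum_(v in G) sg v G * c (G :\ v).

Lemma cobB c b G : cob (fun H => c H - b H) G = cob c G - cob b G.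
Proof. by rewrite /cob -sumrB; apply: eq_bigr => v _; rewrite mulrBr. Qed.

Lemma cobD c b G : cob (fun H => c H + b H) G = cob c G + cob b G.
Proof. by rewrite /cob -big_split; apply: eq_bigr => v _; rewrite mulrDr. Qed.

Lemma eq_cob c b G : (forall v, v \in G -> c (G :\ v) = b (G :\ v)) ->
  cob c G = cob b G.
Proof. by move=> e; apply: eq_bigr => v /e ->. Qed.

Lemma cob_cob c G : cob (cob c) G = 0.
Proof.
rewrite -[RHS](@sum_antisym _ _ G
  (fun v u => sg v G * sg u (G :\ v) * c (G :\ v :\ u))).
  apply: eq_bigr => v vG; rewrite /cob big_distrr /=.
  by apply: eq_big => u; rewrite ?inE 1?andbC // mulrA.
move=> u v uG vG uv.
have Dvu : G :\ u :\ v = G :\ v :\ u.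
  by apply/setP=> w; rewrite !inE andbCA.
set S := G :\ v :\ u.
have Gv : G :\ v = u |: S by rewrite setD1K // !inE uv.
have Gu : G :\ u = v |: S by rewrite /S -Dvu setD1K // !inE eq_sym uv.
have uS : u \notin S by rewrite !inE eqxx.
have vS : v \notin S by rewrite !inE eqxx andbF.
rewrite Dvu -/S -mulNr -(sgD1 _ v G) -(sgD1 _ u G) Gv Gu !sg_self.
rewrite [sg v _ * _]mulrC [sg u _ * _]mulrC sg_anti //.
Qed.

(** The rescaling of cochains that trades the sign [sg v G] for
[sg v W * sg v G], the sign of v in the union of G with a disjoint set W, or in
the complement of G in a larger set W. *)
Definition twist W G : K := \prod_(v in G) sg v W.

Lemma twist_sq W G : twist W G * twist W G = 1.
Proof. by rewrite -big_split big1 // => v _; rewrite /= sg_sq. Qed.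

Lemma cob_twist W c G :
  cob (fun H => twist W H * c H) G
  = twist W G * \sum_(v in G) sg v W * sg v G * c (G :\ v).
Proof.
rewrite big_distrr; apply: eq_bigr => v vG /=.
rewrite /twist [in RHS](bigD1 v) //=.
rewrite [in RHS](eq_bigl (fun i => i \in G :\ v)); last by move=> i; rewrite !inE andbC.
set p := \prod_(_ in _) _; have sq1 := sg_sq K v W; ring: sq1.
Qed.

Definition cocycle D c := forall G, G \in D -> cob c G = 0.
Definition concentrated (p : nat) c := forall G, #|G| != p -> c G = 0.

(** Vanishing of the reduced cohomology of D in degree p - 1: cochains are graded
by the cardinality of the faces rather than by their dimension. *)
Definition acyclic_at D (p : nat) := forall c, concentrated p c -> cocycle D c ->
  exists b, forall G, G \in D -> c G = cob b G.

Lemma concentrated_cob p c : concentrated p c -> concentrated p.+1 (cob c).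
Proof.
move=> dc G Gp; apply: big1 => v vG; rewrite dc ?mulr0 //.
by move: Gp; rewrite (cardsD1 v) vG add1n eqSS.
Qed.

Definition card_part p c G := if #|G| == p then c G else 0.

Lemma concentrated_card_part p c : concentrated p (card_part p c).
Proof. by move=> G; rewrite /card_part; case: eqP. Qed.

Lemma cob_card_part p c G : cob (card_part p c) G = if #|G| == p.+1 then cob c G else 0.
Proof.
case: ifPn => Gp; last exact: (concentrated_cob (@concentrated_card_part p c)).
apply: eq_cob => v vG; rewrite /card_part.
by move: Gp; rewrite (cardsD1 v) vG add1n eqSS => ->.
Qed.

Lemma setU_setD s G : s \subset G -> s :|: (G :\: s) = G.
Proof. by move=> sG; rewrite -{1}(setIidPr sG) setID. Qed.

(** Exterior multiplication by the face s, which identifies the cochains of the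
link of s with the cochains vanishing off the star of s; [unwedge] is its
inverse. The twist makes both commute with the coboundary. *)
Definition wedge s c G : K := if s \subset G then twist s (G :\: s) * c (G :\: s) else 0.
Definition unwedge s c G : K := twist s G * c (s :|: G).

Lemma wedge_unwedge s c G : s \subset G -> wedge s (unwedge s c) G = c G.
Proof.
by move=> sG; rewrite /wedge sG /unwedge mulrA twist_sq mul1r setU_setD.
Qed.

Lemma cob_wedge s c G : cob (wedge s c) G = wedge s (cob c) G.
Proof.
rewrite {2}/wedge; case: ifPn => sG; last first.
  apply: big1 => v vG; rewrite /wedge ifN ?mulr0 //.
  by apply: contra sG => /subset_trans; apply; apply: subD1set.
have sgG v : sg v G = sg v s * sg v (G :\: s) :> K.
  by rewrite -sgU ?setU_setD // -setI_eq0 setIDA setD_eq0 subsetIl.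
have wedge0 v : v \in s -> wedge s c (G :\ v) = 0.
  move=> vs; rewrite /wedge ifN //.
  by apply/subsetPn; exists v => //; rewrite !inE eqxx.
rewrite /cob (bigID (fun v => v \in s)) /= big1 ?add0r; last first.
  by move=> v /andP[_ vs]; rewrite wedge0 ?mulr0.
have := cob_twist s (fun H => twist s H * c H) (G :\: s).
rewrite (@eq_cob _ c); last by move=> v _; rewrite mulrA twist_sq mul1r.
rewrite {1}/cob => ->; rewrite mulrA twist_sq mul1r.
apply: eq_big => v; first by rewrite !inE andbC.
move=> /andP[vG vs]; rewrite sgG /wedge ifT.
  by congr (_ * (_ (_ : V) * c _)); apply/setP=> w; rewrite !inE andbCA.
by apply/subsetP => u us; rewrite !inE (subsetP sG) // andbT; apply: contraNneq vs => <-.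
Qed.

End Coboundary.

(** * Cohomology of a deletion and a link *)

Section Splitting.
Variables (K : fieldType) (n : nat).
Local Notation V := {set 'I_n}.
Implicit Types (c b f : V -> K) (F G H W s t : V) (D E L : {set V}) (v w : 'I_n) (p q r : nat).

Lemma in_del D s G : (G \in face_deletion D s) = (G \in D) && ~~ (s \subset G).
Proof. by rewrite inE. Qed.

Lemma in_link D s G : (G \in link D s) = [&& G \in D, [disjoint G & s] & G :|: s \in D].
Proof. by rewrite inE setI_eq0. Qed.

Lemma closed_del D s : down_closed D -> down_closed (face_deletion D s).
Proof.
move=> dD F G; rewrite !in_del => /andP[FD sF] GF; rewrite (dD F) //=.
by apply: contra sF => /subset_trans; apply.
Qed.

Lemma closed_link D s : down_closed D -> down_closed (link D s).
Proof.
move=> dD F G; rewrite !in_link => /and3P[FD Fs FsD] GF.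
by rewrite (dD F) // (disjointWl GF) // (dD _ _ FsD) // setSU.
Qed.

Lemma link_setD D s G : down_closed D -> s \subset G -> G \in D -> G :\: s \in link D s.
Proof.
move=> dD sG GD; rewrite in_link (dD G) ?subsetDl // disjoint_sym -setI_eq0 setIDA.
by rewrite setD_eq0 subsetIl setUC setU_setD.
Qed.

Lemma link_setU D s G : G \in link D s -> s :|: G \in D.
Proof. by rewrite in_link setUC => /and3P[]. Qed.

Lemma setU_link D s G : G \in link D s -> (s :|: G) :\: s = G.
Proof.
rewrite in_link => /and3P[_ Gs _].
by rewrite setDUl setDv set0U; apply/setDidPl.
Qed.

Lemma card_link D s G : G \in link D s -> #|s :|: G| = (#|G| + #|s|)%N.
Proof.
rewrite in_link -setI_eq0 => /and3P[_ /eqP Gs _].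
by rewrite -cardsUI Gs cards0 addn0 setUC.
Qed.

Lemma wedge_link D s c G : G \in link D s -> wedge s c (s :|: G) = twist K s G * c G.
Proof. by move=> GL; rewrite /wedge subsetUl (setU_link GL). Qed.

Lemma cocycle_wedge D s c : down_closed D -> cocycle (link D s) c -> cocycle D (wedge s c).
Proof.
move=> dD cc G GD; rewrite cob_wedge /wedge; case: ifP => // sG.
by rewrite cc ?mulr0 // link_setD.
Qed.

Lemma cocycle_of_wedge D s c : cocycle D (wedge s c) -> cocycle (link D s) c.
Proof.
move=> cc G GL; have := cc _ (link_setU GL); rewrite cob_wedge (wedge_link _ GL).
by move=> /(congr1 ( *%R (twist K s G))); rewrite mulrA twist_sq mul1r mulr0.
Qed.

Definition off_star s c G : K := if s \subset G then 0 else c G.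
Definition on_star s c G : K := if s \subset G then c G else 0.

Definition not_facet D G := exists2 H, H \in D & G \proper H.

(** Dual to the vanishing, for every m, of the homology in dimension m of the
subcomplex generated by the faces of dimension greater than m, a feature of
sequentially Cohen-Macaulay complexes. *)
Definition facet_concentrated D := forall c, cocycle D c ->
  exists b, forall G, G \in D -> not_facet D G -> c G = cob b G.

(** The part of the shedding condition that does not mention the vertex set, so
that it passes to links. *)
Definition shedding D s := forall t, t \in D -> s \subset t -> forall v, v \in s ->
  exists2 w, w \notin t & (w |: t) :\ v \in D.

(** A face H larger than G and containing s can be replaced by a face of the same
size avoiding s: exchange a vertex v of s outside G by means of the shedding
condition. *)
Lemma not_facet_del D s G : down_closed D -> shedding D s ->
  G \in face_deletion D s -> not_facet D G -> not_facet (face_deletion D s) G.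
Proof.
move=> dD sh; rewrite in_del => /andP[GD sG] [H HD GH].
have [sH|sH] := boolP (s \subset H); last by exists H => //; rewrite in_del HD.
have /subsetPn[v vs vG] := sG.
have [w wH wD] := sh H HD sH v vs.
exists ((w |: H) :\ v); first by rewrite in_del wD; apply/subsetPn; exists v; rewrite // !inE eqxx.
have vH := subsetP sH v vs.
rewrite properEcard subsetD1 vG andbT subsetU ?(proper_sub GH) ?orbT //=.
have -> : #|(w |: H) :\ v| = #|H|.
  have := cardsD1 v (w |: H); rewrite !inE vH orbT cardsU1 wH.
  by move=> /eqP; rewrite eqn_add2l => /eqP <-.
exact: proper_card.
Qed.

(** The vanishing of the connecting map at the level of cochains: once corrected,
the cocycle lives on facets of the deletion, which are facets of D, and there is
no larger face where its extension by 0 could have a coboundary. *)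
Lemma extend_cocycle D s c : down_closed D -> shedding D s ->
  facet_concentrated (face_deletion D s) -> cocycle (face_deletion D s) c ->
  exists b, cocycle D (off_star s (fun G => c G - cob b G)) /\
   forall G, G \in face_deletion D s -> not_facet D G -> c G = cob b G.
Proof.
move=> dD sh fE cE; have [b cb] := fE c cE.
have cb' G : G \in face_deletion D s -> not_facet D G -> c G = cob b G.
  by move=> GE nf; apply: cb => //; apply: not_facet_del.
exists b; split=> // G GD; apply: big1 => v vG.
rewrite /off_star; case: ifPn => sG; rewrite ?mulr0 //.
rewrite cb' ?subrr ?mulr0 //.
  by rewrite in_del sG (dD G) // subD1set.
by exists G => //; apply: properD1.
Qed.

Lemma on_off_star s c G : c G = on_star s c G + off_star s c G.
Proof. by rewrite /on_star /off_star; case: ifP; rewrite ?addr0 ?add0r. Qed.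

Lemma on_starE s c G : on_star s c G = wedge s (unwedge s c) G.
Proof. by rewrite /on_star; case: ifPn => sG; [rewrite wedge_unwedge | rewrite /wedge (negPf sG)]. Qed.

Lemma eq_cocycle D c b : (forall G, c G = b G) -> cocycle D c -> cocycle D b.
Proof. by move=> e cc G /cc <-; apply: eq_cob => v _; rewrite e. Qed.

Lemma cocycleB D c b : cocycle D c -> cocycle D b -> cocycle D (fun G => c G - b G).
Proof. by move=> cc cb G GD; rewrite cobB cc // cb // subrr. Qed.

Lemma cocycle_cob D b : cocycle D (cob b).
Proof. by move=> G _; apply: cob_cob. Qed.

Lemma cocycle_sub D E c : (forall G, G \in E -> G \in D) -> cocycle D c -> cocycle E c.
Proof. by move=> ED cD G /ED; apply: cD. Qed.

Lemma del_sub D s G : G \in face_deletion D s -> G \in D.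
Proof. by rewrite in_del => /andP[]. Qed.

(** Correct c on the deletion first; what remains splits into a part supported on
facets and a part supported on the star of s, that is, a cocycle of the link. *)
Lemma facet_concentrated_shedding D s : down_closed D -> shedding D s ->
  facet_concentrated (face_deletion D s) -> facet_concentrated (link D s) ->
  facet_concentrated D.
Proof.
move=> dD sh fE fL c cD.
have [b [cf cb]] := extend_cocycle dD sh fE (cocycle_sub (@del_sub D s) cD).
pose c1 G := c G - cob b G.
have con : cocycle D (on_star s c1).
  apply: eq_cocycle (cocycleB (cocycleB cD (@cocycle_cob D b)) cf) => G.
  by rewrite -/(c1 G) -/(c1) [X in X - _](on_off_star s) addrK.
have cl : cocycle (link D s) (unwedge s c1).
  by apply: cocycle_of_wedge; apply: eq_cocycle con => G; rewrite on_starE.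
have [b' cb'] := fL _ cl.
exists (fun G => b G + wedge s b' G) => G GD [H HD GH]; rewrite cobD cob_wedge.
rewrite /wedge; case: ifPn => sG; last first.
  by rewrite addr0; apply: cb; [rewrite in_del GD | exists H].
have sH := subset_trans sG (proper_sub GH).
rewrite -cb'; last 2 first.
- exact: link_setD.
- exists (H :\: s); first exact: link_setD.
  rewrite properEneq setSD ?(proper_sub GH) // andbT.
  apply: contraTneq GH => e.
  by rewrite -(setU_setD sG) e setU_setD // properxx.
by rewrite /unwedge mulrA twist_sq mul1r setU_setD // /c1 addrC subrK.
Qed.

(** The part of b that contributes to [cob b] on sets of cardinality p; unlike
[card_part p.-1] it is zero for p = 0. *)
Definition pred_part p b G : K := if #|G|.+1 == p then b G else 0.

Lemma cob_pred_part p b G : cob (pred_part p b) G = if #|G| == p then cob b G else 0.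
Proof.
have cardG v : v \in G -> #|G :\ v|.+1 = #|G| by move=> vG; rewrite (cardsD1 v G) vG.
case: ifPn => Gp; first by apply: eq_cob => v vG; rewrite /pred_part cardG // Gp.
by apply: big1 => v vG; rewrite /pred_part cardG // (negPf Gp) mulr0.
Qed.

Lemma acyclic_deg D p c : acyclic_at K D p -> concentrated p c -> cocycle D c ->
  exists b, concentrated p (cob b) /\ forall G, G \in D -> c G = cob b G.
Proof.
move=> aD dc cD; have [b cb] := aD c dc cD; exists (pred_part p b).
split=> G; rewrite cob_pred_part; first by case: eqP.
by move=> GD; case: eqP => [_|/eqP /dc //]; apply: cb.
Qed.

(** Relative cohomology of the pair formed by D and the deletion of s is the
cohomology of the link of s, shifted by |s|. *)
Lemma wedge_coboundary D s p c : down_closed D -> concentrated p c -> cocycle D c ->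
  (forall G, G \in D -> ~~ (s \subset G) -> c G = 0) ->
  (forall q, (q + #|s|)%N = p -> acyclic_at K (link D s) q) ->
  exists b, forall G, G \in D -> c G = cob (wedge s b) G.
Proof.
move=> dD dc cD c0 aL.
have cE G : G \in D -> c G = wedge s (unwedge s c) G.
  by move=> GD; rewrite -on_starE /on_star; case: ifPn => // /(c0 _ GD).
have cL : cocycle (link D s) (unwedge s c).
  apply: cocycle_of_wedge => G GD; rewrite -[RHS](cD _ GD).
  by apply: eq_cob => v _; rewrite -cE // (dD _ _ GD) // subD1set.
have [sp|sp] := leqP #|s| p; last first.
  exists (fun=> 0) => G GD; rewrite cob_wedge /wedge; case: ifP => [sG|/negbT/(c0 _ GD)//].
  rewrite [cob _ _]big1 => [|v _]; last by rewrite mulr0.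
  by rewrite mulr0 dc // neq_ltn (leq_trans sp) ?orbT // subset_leq_card.
have Ec G : G \in link D s -> card_part (p - #|s|) (unwedge s c) G = unwedge s c G.
  move=> GL; rewrite /card_part; case: eqP => // /eqP Gp; rewrite /unwedge dc ?mulr0 //.
  by rewrite (card_link GL); apply: contra Gp => /eqP <-; rewrite addnK.
have [|b cb] := aL _ (subnK sp) _ (@concentrated_card_part _ _ _ (unwedge s c)).
  move=> G GL; rewrite -[RHS](cL _ GL); apply: eq_cob => v _.
  by rewrite Ec // (closed_link dD GL) // subD1set.
exists b => G GD; rewrite cE // cob_wedge /wedge.
by case: ifP => // sG; rewrite -cb ?link_setD // Ec ?link_setD.
Qed.

(** This lemma and the next two are the exactness of the long exact sequence of
the pair at its three kinds of terms. *)
Lemma acyclic_of_del_link D s p : down_closed D ->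
  acyclic_at K (face_deletion D s) p ->
  (forall q, (q + #|s|)%N = p -> acyclic_at K (link D s) q) ->
  acyclic_at K D p.
Proof.
move=> dD aE aL c dc cD.
have [b [db cb]] := acyclic_deg aE dc (cocycle_sub (@del_sub D s) cD).
have [||G GD sG|b1 cb1] := @wedge_coboundary D s p (fun G => c G - cob b G) dD _ _ _ aL.
- by move=> G Gp; rewrite dc // db // subrr.
- exact/cocycleB/cocycle_cob.
- by rewrite cb ?subrr // in_del GD.
by exists (fun G => b G + wedge s b1 G) => G GD; rewrite cobD -cb1 // addrC subrK.
Qed.

Lemma acyclic_del D s p : down_closed D -> acyclic_at K D p ->
  (forall q, (q + #|s|)%N = p.+1 -> acyclic_at K (link D s) q) ->
  acyclic_at K (face_deletion D s) p.
Proof.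
move=> dD aD aL c dc cE.
pose c0 := off_star s c.
have dc0 : concentrated p c0 by move=> G Gp; rewrite /c0 /off_star dc //; case: ifP.
have [|G GD sG|b cb] := wedge_coboundary dD (concentrated_cob dc0) _ _ aL.
- exact: cocycle_cob.
- rewrite -[RHS](cE G) ?in_del ?GD //; apply: eq_cob => v vG.
  rewrite /c0 /off_star ifN //; apply: contra sG => /subset_trans; apply.
  exact: subD1set.
have [|G GD|b1 cb1] := aD (card_part p (fun G => c0 G - wedge s b G)).
- exact: concentrated_card_part.
- by rewrite cob_card_part cobB cb // subrr; case: ifP.
exists b1 => G; rewrite in_del => /andP[GD sG]; rewrite -cb1 // /card_part.
rewrite /wedge (negPf sG) subr0 /c0 /off_star (negPf sG).
by case: eqP => // /eqP /dc.
Qed.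

(** Injectivity of the map from the cohomology of the link to that of D, from the
vanishing of the connecting map just before it. *)
Lemma acyclic_link_of_extension D s q : down_closed D ->
  (forall c r, (q + #|s|)%N = r.+1 -> concentrated r c -> cocycle (face_deletion D s) c ->
    exists b, cocycle D (off_star s (fun G => c G - cob b G))) ->
  acyclic_at K D (q + #|s|) -> acyclic_at K (link D s) q.
Proof.
move=> dD ext aD c dc cL.
have [||b cb] := aD (wedge s c).
- move=> G Gp; rewrite /wedge; case: ifP => // sG; rewrite dc ?mulr0 //.
  by apply: contra Gp => /eqP <-; rewrite cardsDS // subnK // subset_leq_card.
- exact: cocycle_wedge.
(* Subtracting a coboundary and a cocycle of D from b makes it vanish off the
   star of s without changing its coboundary. *)
have [b2 [b2s cb2]] : exists b2, (forall G, b2 G = on_star s b2 G) /\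
   forall G, G \in D -> #|G| = (q + #|s|)%N -> cob b2 G = cob b G.
  have [s0|s0] := posnP (q + #|s|)%N.
    exists (fun=> 0); split=> [G|G GD]; first by rewrite /on_star; case: ifP.
    rewrite s0 => /eqP; rewrite cards_eq0 => /eqP ->.
    by rewrite /cob !big_set0.
  have [||b1 cb1] := ext (pred_part (q + #|s|) b) _ (esym (prednK s0)).
  - by move=> G; rewrite /pred_part -{2}(prednK s0) eqSS; case: eqP.
  - move=> G; rewrite in_del => /andP[GD sG]; rewrite cob_pred_part -cb // /wedge (negPf sG).
    by case: ifP.
  exists (on_star s (fun G => pred_part (q + #|s|) b G - cob b1 G)).
  split=> [G|G GD Gq]; first by rewrite /on_star; case: ifP.
  rewrite -[LHS]addr0 -[X in _ + X](cb1 G GD) -cobD.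
  transitivity (cob (fun G => pred_part (q + #|s|) b G - cob b1 G) G).
    by apply: eq_cob => v _; rewrite -on_off_star.
  by rewrite cobB cob_cob subr0 cob_pred_part Gq eqxx.
exists (pred_part q (unwedge s b2)) => G GL; rewrite cob_pred_part.
case: eqP => [Gq|/eqP /dc //]; have GD := link_setU GL.
have := cb _ GD; rewrite -cb2 // ?(card_link GL) ?Gq // (wedge_link _ GL).
rewrite (@eq_cob _ _ b2 (wedge s (unwedge s b2))) => [|v _]; last by rewrite -on_starE.
rewrite cob_wedge (wedge_link _ GL) => /(congr1 ( *%R (twist K s G))).
by rewrite !mulrA twist_sq !mul1r.
Qed.

Lemma acyclic_link D s q : down_closed D -> acyclic_at K D (q + #|s|) ->
  (forall r, (q + #|s|)%N = r.+1 -> acyclic_at K (face_deletion D s) r) ->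
  acyclic_at K (link D s) q.
Proof.
move=> dD aD aE; apply: acyclic_link_of_extension => // c r qr dc cE.
have [b [db cb]] := acyclic_deg (aE r qr) dc cE.
exists b => G GD; apply: big1 => v vG; rewrite /off_star; case: ifPn => sG; rewrite ?mulr0 //.
by rewrite cb ?subrr ?mulr0 // in_del sG (dD _ _ GD) // subD1set.
Qed.

(** The connecting maps vanish, so the long exact sequence breaks up. *)
Lemma acyclic_shedding D s p : down_closed D -> shedding D s ->
  facet_concentrated (face_deletion D s) ->
  acyclic_at K D p <-> acyclic_at K (face_deletion D s) p /\
    (forall q, (q + #|s|)%N = p -> acyclic_at K (link D s) q).
Proof.
move=> dD sh fE; split=> [aD|[aE aL]]; last exact: (acyclic_of_del_link dD aE aL).
split=> [c dc cE|q qp]; last first.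
  apply: acyclic_link_of_extension => //; last by rewrite qp.
  move=> c r _ _ cE; have [b [cb _]] := extend_cocycle dD sh fE cE; by exists b.
have [b [cf _]] := extend_cocycle dD sh fE cE.
have [||b1 cb1] := aD (card_part p (off_star s (fun G => c G - cob b G))).
- exact: concentrated_card_part.
- by move=> G GD; rewrite cob_card_part cf //; case: ifP.
exists (pred_part p (fun G => b G + b1 G)) => G; rewrite in_del => /andP[GD sG].
rewrite cob_pred_part cobD; case: ifPn => [Gp|/dc //].
by rewrite -(cb1 _ GD) /card_part Gp /off_star (negPf sG) addrC subrK.
Qed.

End Splitting.

(** * Links of a decomposable complex *)

Section Links.
Variables (K : fieldType) (n : nat).
Local Notation V := {set 'I_n}.
Implicit Types (c b f : V -> K) (F G H W A B Y s t : V) (D E L : {set V}) (v w : 'I_n) (p q r : nat).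

Lemma link_powerset A F : F \subset A -> link (powerset A) F = powerset (A :\: F).
Proof.
move=> FA; apply/setP=> G; rewrite in_link !powersetE subUset FA andbT subsetD.
by case: (G \subset A); rewrite ?andbF //= andbT.
Qed.

Lemma link_notin D F : down_closed D -> F \notin D -> link D F = set0.
Proof.
move=> dD FD; apply/setP=> G; rewrite in_link inE; apply: contraNF FD => /and3P[_ _ /dD].
by apply; apply: subsetUr.
Qed.

Lemma link_set0 D : link D set0 = D.
Proof.
by apply/setP=> G; rewrite in_link setU0 andbA andbC -setI_eq0 setI0 eqxx andbT andbb.
Qed.

(** Stated with B minus A so that no disjointness is required; exchanging the
roles of A and B gives the commutation of links. *)
Lemma link_link D A B : down_closed D -> link (link D A) (B :\: A) = link D (A :|: B).
Proof.
move=> dD; apply/setP=> G; rewrite !in_link.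
have -> : G :|: B :\: A :|: A = G :|: (A :|: B).
  by apply/setP=> x; rewrite !inE; do 3!case: (x \in _).
have -> : [disjoint G :|: B :\: A & A] = [disjoint G & A].
  rewrite -!setI_eq0; congr (_ == _).
  by apply/setP=> x; rewrite !inE; do 3!case: (x \in _).
have -> : [disjoint G & A :|: B] = [disjoint G & A] && [disjoint G & B :\: A].
  rewrite -!setI_eq0 -setU_eq0 -setIUr; congr (_ == _).
  by apply/setP=> x; rewrite !inE; do 3!case: (x \in _).
have [GD|GD] := boolP (G :|: (A :|: B) \in D); last by rewrite !andbF.
have GAD : G :|: A \in D by apply: dD GD _; rewrite setUS ?subsetUl.
have GBD : G :|: B :\: A \in D.
  by apply: dD GD _; rewrite setUS // (subset_trans (subsetDl _ _)) ?subsetUr.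
rewrite GAD GBD (dD _ _ GAD) ?subsetUl // !andbT /=.
by case: [disjoint G & A] => //=; rewrite ?andbT ?andbF.
Qed.

Lemma del_link D F s : face_deletion (link D F) (s :\: F) = link (face_deletion D s) F.
Proof.
apply/setP=> G; rewrite !(in_del, in_link) -!subDset; rewrite subDset.
have -> : (s \subset G :|: F) = (s :\: F \subset G) by rewrite setUC -subDset.
have [sG|sG] := boolP (s :\: F \subset G); first by rewrite !andbF.
rewrite !andbT /= (_ : s \subset G = false) ?andbT //.
by apply: contraNF sG => /(subset_trans (subsetDl _ _)).
Qed.

Lemma link_del_notin D F s : down_closed D -> s :|: F \notin D ->
  link (face_deletion D s) F = link D F.
Proof.
move=> dD sF; rewrite -del_link; apply/setP=> G; rewrite in_del in_link.
case: (boolP (G :|: F \in D)) => [GD|]; last by rewrite !andbF.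
have -> : s :\: F \subset G = false; last by rewrite /= !andbT.
apply: contraNF sF => sFG; apply: dD GD _; rewrite subUset subsetUr andbT.
by rewrite setUC -subDset.
Qed.

Lemma shedding_link D F s : down_closed D -> shedding D s ->
  shedding (link D F) (s :\: F).
Proof.
move=> dD sh t; rewrite in_link => /and3P[tD tF tFD] st v; rewrite inE => /andP[vF vs].
have stF : s \subset t :|: F by rewrite setUC -subDset.
have [w] := sh _ tFD stF v vs; rewrite inE negb_or => /andP[wt wF] wD.
exists w => //; rewrite in_link.
have e : (w |: t) :\ v :|: F = (w |: (t :|: F)) :\ v.
  apply/setP=> x; rewrite !inE; case: (eqVneq x v) => [->|] /=; last by rewrite orbA.
  exact: negPf.
rewrite e wD (dD _ _ wD) ?setSD ?setUA ?subsetUl // andbT /=.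
rewrite -setI_eq0 setIDAC setIUl (eqP (_ : t :&: F == set0)) ?setI_eq0 // setU0.
by rewrite (_ : [set w] :&: F = set0) ?set0D //; apply/eqP; rewrite setI_eq0 disjoints1.
Qed.

(** A simplex is a cone over any of its vertices a, and the proof contracts it to
a. *)
Lemma facet_concentrated_simplex A : facet_concentrated K (powerset A).
Proof.
move=> c cA; have [->|[a aA]] := set_0Vmem A.
  exists c => G; rewrite inE subset0 => /eqP-> [H].
  by rewrite inE subset0 => /eqP ->; rewrite properxx.
exists (fun G => if a \in G then 0 else sg a G * c (a |: G)) => G GA _.
rewrite inE in GA; rewrite /cob.
have [aG|aG] := boolP (a \in G).
  rewrite (bigD1 a) //= !inE eqxx /= setD1K // big1 ?addr0 => [|v /andP[_ va]].
    by rewrite mulrA sgD1 sg_sq mul1r.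
  by rewrite !inE aG eq_sym va mulr0.
have := cA (a |: G); rewrite inE subUset sub1set aA GA => /(_ isT).
rewrite /cob big_setU1 //= setU1K // sg_self => e.
rewrite -[LHS]mul1r -(sg_sq K a G) -mulrA.
move/eqP: e; rewrite addrC addr_eq0 => /eqP/(congr1 -%R); rewrite opprK => <-.
rewrite mulrN big_distrr -sumrN; apply: eq_bigr => v vG /=.
have av : a != v by apply: contraNneq aG => ->.
rewrite !inE (negPf av) (negPf aG) /=.
have -> : (a |: G) :\ v = a |: G :\ v.
  by apply/setP=> x; rewrite !inE; case: (eqVneq x v) => // ->; rewrite eq_sym (negPf av).
rewrite !mulrA -mulNr; congr (_ * _).
rewrite -{1}(setD1K vG) !sgU1 ?inE ?eqxx //.
have : (v < a)%N || (a < v)%N by rewrite -neq_ltn eq_sym.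
by case: ltngtP => // _ _; rewrite ?mulN1r ?mul1r ?mulrN ?mulNr ?opprK mulrC.
Qed.

(** By induction on decomposability: the link of F inherits the shedding face
s minus F if F and s lie in a common face, and otherwise it equals the link of F
in the deletion. *)
Lemma facet_concentrated_link k Y D : decomposable k Y D -> down_closed D ->
  forall F, facet_concentrated K (link D F).
Proof.
elim=> {Y D} [Y|Y A AY|Y D s [sD sh] _ _ IHE _ IHL] dD F.
- by rewrite link_notin ?inE // => c _; exists c => G; rewrite inE.
- have [FA|FA] := boolP (F \subset A).
    by rewrite link_powerset //; apply: facet_concentrated_simplex.
  by rewrite link_notin ?inE // => c _; exists c => G; rewrite inE.
have dE := closed_del (s := s) dD; have dL := closed_link (s := s) dD.
have [sFD|sFD] := boolP (s :|: F \in D); last first.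
  by rewrite -(link_del_notin dD sFD); apply: IHE.
apply: (@facet_concentrated_shedding _ _ _ (s :\: F)).
- exact: closed_link.
- apply: shedding_link => // t tD st v vs.
  by have [w] := sh t tD st v vs; rewrite inE => /andP[wt _]; exists w.
- by rewrite del_link; apply: IHE.
- by rewrite link_link // setUC -link_link //; apply: IHL.
Qed.

(** * Restrictions and links have the same extremal cohomology *)

Definition restr D W : {set V} := [set G in D | G \subset W].

Lemma closed_restr D W : down_closed D -> down_closed (restr D W).
Proof.
move=> dD F G; rewrite !inE => /andP[FD FW] GF.
by rewrite (dD _ _ FD GF) (subset_trans GF).
Qed.

(** Links in restrictions interpolate between restrictions (F empty) and links
(W full). This identity and [link_link] put the pairs (W, F), (v |: W, F) and
(v |: W, v |: F) in one long exact sequence. *)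
Lemma del_link_restr D W F v : F \subset W -> v \notin W ->
  face_deletion (link (restr D (v |: W)) F) [set v] = link (restr D W) F.
Proof.
move=> FW vW; apply/setP=> G; rewrite in_del !in_link !inE sub1set.
have FvW : F \subset v |: W by rewrite (subset_trans FW) ?subsetUr.
rewrite !subUset FW FvW !andbT.
have -> : (G \subset W) = (G \subset v |: W) && (v \notin G).
  apply/idP/andP=> [GW|[GW vG]].
    split; first by rewrite (subset_trans GW) ?subsetUr.
    by apply: contra vW; apply: (subsetP GW).
  apply/subsetP=> x xG; have := subsetP GW x xG; rewrite !inE.
  by case/orP=> // /eqP xv; rewrite -xv xG in vG.
by case: (v \in G); case: (G \subset _); rewrite ?andbF ?andbT.
Qed.

Lemma acyclic_set0 p : acyclic_at K (set0 : {set V}) p.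
Proof. by move=> c _ _; exists c => G; rewrite inE. Qed.

(** Add the vertices outside W one at a time. At each step the long exact
sequence gives nonzero cohomology in the same degree, either for the same face
or for that face enlarged by the new vertex. *)
Lemma link_of_restr D Y W F p : down_closed D -> F \subset W -> W \subset Y ->
  ~ acyclic_at K (link (restr D W) F) p ->
  exists F', [/\ F' \subset Y, (#|F'| + #|W| <= #|Y| + #|F|)%N
               & ~ acyclic_at K (link (restr D Y) F') p].
Proof.
move=> dD; have [m] := ubnP #|Y :\: W|; elim: m => // m IHm in W F *.
rewrite ltnS => YWm FW WY nac.
have [YW|[v]] := set_0Vmem (Y :\: W).
  have -> : Y = W by apply/eqP; rewrite eqEsubset WY andbT -setD_eq0 YW.
  by exists F; rewrite addnC.
rewrite inE => /andP[vW vY].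
have vWY : v |: W \subset Y by rewrite subUset sub1set vY.
have YvWm : (#|Y :\: (v |: W)| < m)%N.
  apply: leq_trans YWm; apply: proper_card; rewrite properE setDS ?subsetUr //=.
  by apply/subsetPn; exists v; rewrite !inE ?vW ?vY // eqxx.
have vF : v \notin F by apply: contra vW; apply: (subsetP FW).
have FvW : F \subset v |: W by rewrite (subset_trans FW) ?subsetUr.
have dR := closed_restr (W := v |: W) dD.
have card_vW : #|v |: W| = #|W|.+1 by rewrite cardsU1 vW.
have [ac1|nac1] := pselect (acyclic_at K (link (restr D (v |: W)) F) p); last first.
  have [F' [F'Y F'c F'n]] := IHm _ _ YvWm FvW vWY nac1.
  by exists F'; split=> //; move: F'c; rewrite card_vW; lia.
have [ac2|nac2] := pselect (acyclic_at K (link (restr D (v |: W)) (F :|: [set v])) p).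
  case: nac; rewrite -(del_link_restr D FW vW); apply: acyclic_del => //.
    exact: closed_link.
  move=> q; rewrite cards1 addn1 => -[->].
  move: ac2; rewrite -link_link //.
  by have /setDidPl-> : [disjoint [set v] & F] by rewrite disjoints1.
have [|F' [F'Y F'c F'n]] := IHm _ _ YvWm _ vWY nac2; first by rewrite setUC setUS.
exists F'; split=> //; move: F'c.
by rewrite card_vW setUC cardsU1 vF !addnS ltnS.
Qed.

(** Remove the vertices of F one at a time; each step either raises the degree by
one or removes the vertex from W as well. *)
Lemma restr_of_link D W F p : down_closed D -> F \subset W ->
  ~ acyclic_at K (link (restr D W) F) p ->
  exists W' p', [/\ W' \subset W, (p <= p')%N, (#|W'| + #|F| + p)%N = (#|W| + p')%N
                 & ~ acyclic_at K (restr D W') p'].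
Proof.
move=> dD; have [m] := ubnP #|F|; elim: m => // m IHm in W F p *.
rewrite ltnS => Fm FW nac.
have [F0|[v vF]] := set_0Vmem F.
  by exists W, p; move: nac; rewrite F0 link_set0 cards0 addn0.
have cF : #|F| = #|F :\ v|.+1 by rewrite (cardsD1 v) vF.
have F'm : (#|F :\ v| < m)%N by rewrite -cF.
have vW := subsetP FW v vF.
have F'W : F :\ v \subset W by rewrite (subset_trans _ FW) ?subD1set.
have dR := closed_restr (W := W) dD.
have [ac1|nac1] := pselect (acyclic_at K (link (restr D W) (F :\ v)) p.+1); last first.
  have [W' [p' [W'W pp' e W'n]]] := IHm _ _ _ F'm F'W nac1.
  by exists W', p'; split=> //; [exact: ltnW | rewrite cF -e !addnS addSn].
have F'W' : F :\ v \subset W :\ v by rewrite setSD.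
have [ac2|nac2] := pselect (acyclic_at K (link (restr D (W :\ v)) (F :\ v)) p).
  case: nac; rewrite -(setD1K vF) setUC -link_link //.
  have -> : [set v] :\: (F :\ v) = [set v].
    by apply/setDidPl; rewrite disjoints1 !inE eqxx.
  apply: acyclic_link; rewrite ?cards1 ?addn1 //; first exact: closed_link.
  by move=> r [<-]; rewrite -{1}(setD1K vW) del_link_restr // !inE eqxx.
have [W' [p' [W'W pp' e W'n]]] := IHm _ _ _ F'm F'W' nac2.
exists W', p'; split=> //; first by rewrite (subset_trans W'W) ?subD1set.
by rewrite cF addnS addSn e (cardsD1 v W) vW.
Qed.

(** The pairs (i, p) for which Hochster's formula makes the Betti number in
degrees i and p + i nonzero. *)
Definition hochster Y D i p :=
  exists W, [/\ W \subset Y, #|W| = (p + i)%N & ~ acyclic_at K (restr D W) p].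

(** The same with links, as in the description of the local cohomology of a
Stanley-Reisner ring. *)
Definition link_hochster Y D i p :=
  exists F, [/\ F \subset Y, #|Y| = (p + i + #|F|)%N & ~ acyclic_at K (link D F) p].

Definition faces_in Y D := forall G, G \in D -> G \subset Y.

Lemma restr_full Y D : faces_in Y D -> restr D Y = D.
Proof. by move=> DY; apply/setP=> G; rewrite inE; case: (boolP (G \in D)) => // /DY. Qed.

Lemma hochster_to_link Y D i p : down_closed D -> faces_in Y D -> hochster Y D i p ->
  exists2 i', (i <= i')%N & link_hochster Y D i' p.
Proof.
move=> dD DY [W [WY Wc nac]].
have [|F [FY Fc Fn]] := @link_of_restr D Y W set0 p dD (sub0set _) WY.
  by rewrite link_set0.
rewrite cards0 addn0 Wc restr_full // in Fc Fn.
exists (#|Y| - p - #|F|)%N; first by lia.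
by exists F; split=> //; lia.
Qed.

Lemma link_to_hochster Y D i p : down_closed D -> faces_in Y D -> link_hochster Y D i p ->
  exists2 p', (p <= p')%N & hochster Y D i p'.
Proof.
move=> dD DY [F [FY Fc nac]]; rewrite -(restr_full DY) in nac.
have [W [p' [WY pp' e Wn]]] := restr_of_link dD FY nac.
by exists p' => //; exists W; split=> //; lia.
Qed.

(** In terms of links the passage to the deletion and to the link of s is exact:
i is kept and p moves by the number of vertices of s outside the face. *)
Lemma link_hochster_shedding k Y D s : down_closed D -> faces_in Y D -> shedding D s ->
  s \in D -> decomposable k Y (face_deletion D s) ->
  [/\ forall i p, link_hochster Y D i p -> link_hochster Y (face_deletion D s) i p \/
       exists2 q, (p <= q + #|s|)%N & link_hochster (Y :\: s) (link D s) i q,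
     forall i p, link_hochster Y (face_deletion D s) i p -> link_hochster Y D i p
   & forall i q, link_hochster (Y :\: s) (link D s) i q ->
       link_hochster Y D i (q + #|s|)].
Proof.
move=> dD DY sh sD decE; have dE := closed_del (s := s) dD.
have fE := facet_concentrated_link decE dE.
have sY := DY s sD.
have split F p : acyclic_at K (link D F) p <-> acyclic_at K (link (face_deletion D s) F) p /\
    (forall q, (q + #|s :\: F|)%N = p -> acyclic_at K (link D (s :|: F)) q).
  rewrite -del_link -[s :|: F]setUC -link_link //.
  apply: acyclic_shedding; [exact: closed_link | exact: shedding_link |].
  by rewrite del_link.
have linkL F : link (link D s) (F :\: s) = link D (s :|: F) by rewrite link_link.
split=> i p [F [FY Fc nac]].
- have [sFD|sFD] := boolP (s :|: F \in D); last first.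
    by left; exists F; split=> //; rewrite link_del_notin.
  have [acE|nacE] := pselect (acyclic_at K (link (face_deletion D s) F) p); last first.
    by left; exists F.
  right; have /existsNP[q /not_implyP[qp nacL]] :
      ~ forall q, (q + #|s :\: F|)%N = p -> acyclic_at K (link D (s :|: F)) q.
    by move=> h; apply: nac; apply/split.
  exists q; first by rewrite -qp leq_add2l subset_leq_card // subsetDl.
  exists (F :\: s); split; [by rewrite setSD| | by rewrite linkL].
  have := cardsID s F; have := cardsID F s; have := cardsDS sY; rewrite setIC.
  have := subset_leq_card sY; lia.
- exists F; split=> // ac; apply: nac.
  have [sFD|sFD] := boolP (s :|: F \in D); last by rewrite link_del_notin.
  by have /split[] := ac.
- have [FL|FL] := boolP (F \in link D s); last first.
    by case: nac; rewrite link_notin; [exact: acyclic_set0 | exact: closed_link |].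
  have dFs : [disjoint F & s] by move: FL; rewrite in_link => /and3P[].
  exists F; split; first by rewrite (subset_trans FY) ?subsetDl.
    by have := cardsDS sY; have := subset_leq_card sY; lia.
  move=> /split[_ acL]; apply: nac.
  have /setDidPl <- : [disjoint F & s] by [].
  rewrite linkL; apply: acL; congr (_ + _)%N; apply: eq_card.
  by have /setDidPl-> : [disjoint s & F] by rewrite disjoint_sym.
Qed.

(** What survives for restrictions of the exact statement for links: equality up
to increasing i and p, which is all that maxima can see. *)
Lemma hochster_shedding k Y D s : down_closed D -> faces_in Y D -> shedding D s ->
  s \in D -> decomposable k Y (face_deletion D s) ->
  [/\ forall i p, hochster Y D i p ->
       (exists i' p', [/\ (i <= i')%N, (p <= p')%N & hochster Y (face_deletion D s) i' p']) \/
       (exists i' q, [/\ (i <= i')%N, (p <= q + #|s|)%N & hochster (Y :\: s) (link D s) i' q]),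
     forall i p, hochster Y (face_deletion D s) i p ->
       exists i' p', [/\ (i <= i')%N, (p <= p')%N & hochster Y D i' p']
   & forall i q, hochster (Y :\: s) (link D s) i q ->
       exists i' p', [/\ (i <= i')%N, (q + #|s| <= p')%N & hochster Y D i' p']].
Proof.
move=> dD DY sh sD decE.
have [h1 h2 h3] := link_hochster_shedding dD DY sh sD decE.
have dE := closed_del (s := s) dD; have dL := closed_link (s := s) dD.
have EY : faces_in Y (face_deletion D s) by move=> G /del_sub /DY.
have LY : faces_in (Y :\: s) (link D s).
  by move=> G; rewrite in_link subsetD => /and3P[/DY -> -> _].
split=> i p.
- move=> /(hochster_to_link dD DY)[i' ii' /h1[]].
    by move=> /(link_to_hochster dE EY)[p' pp' h]; left; exists i', p'.
  move=> [q pq /(link_to_hochster dL LY)[q' qq' h]]; right; exists i', q'; split=> //.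
  by rewrite (leq_trans pq) // leq_add2r.
- move=> /(hochster_to_link dE EY)[i' ii' /h2 /(link_to_hochster dD DY)[p' pp' h]].
  by exists i', p'.
- move=> /(hochster_to_link dL LY)[i' ii' /h3 /(link_to_hochster dD DY)[p' pp' h]].
  by exists i', p'.
Qed.

End Links.

(** * Homogeneous parts of polynomials *)

Section HomogeneousParts.
Variables (K : fieldType) (n : nat).
Local Notation R := {mpoly K[n]}.
Implicit Types (p q : R) (d e : int) (m : 'X_{1..n}).

Definition mfilter (P : pred 'X_{1..n}) p : R :=
  \sum_(m <- msupp p | P m) p@_m *: 'X_[m].

Lemma mcoeff_mfilter P p m : (mfilter P p)@_m = if P m then p@_m else 0.
Proof.
rewrite /mfilter raddf_sum /=.
rewrite (eq_bigr (fun i => if i == m then p@_m else 0)) => [|i _]; last first.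
  by rewrite mcoeffZ mcoeffX; case: eqP => [->|_]; rewrite ?mulr1 ?mulr0.
rewrite -big_mkcondr -big_filter.
have [mp|/memN_msupp_eq0 pm0] := boolP (m \in msupp p); last first.
  by rewrite pm0 big1 // if_same.
rewrite big_filter (eq_bigl (fun i => P m && (i == m))); last first.
  by move=> i; case: eqP => [->|]; rewrite ?andbF ?andbT.
case: (P m) => /=; last by rewrite big_pred0.
by rewrite -big_filter filter_pred1_uniq ?msupp_uniq // big_seq1.
Qed.

Definition hpart d := mfilter (fun m => (mdeg m)%:Z == d).

Lemma mcoeff_hpart d p m : (hpart d p)@_m = if (mdeg m)%:Z == d then p@_m else 0.
Proof. exact: mcoeff_mfilter. Qed.

Lemma hom_coeff d p m : homogeneous_of_degree d p -> p@_m != 0 -> (mdeg m)%:Z = d.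
Proof. by move=> hp pm; apply: hp; rewrite mcoeff_msupp. Qed.

Lemma hom_hpart d p : homogeneous_of_degree d (hpart d p).
Proof. by move=> m; rewrite mcoeff_msupp mcoeff_hpart; case: ifP => [/eqP|_ /eqP]. Qed.

Lemma hpart_id d p : homogeneous_of_degree d p -> hpart d p = p.
Proof.
move=> hp; apply/mpolyP => m; rewrite mcoeff_hpart; case: eqP => // ne.
by apply/esym/eqP; apply: contra_notT ne => /(hom_coeff hp).
Qed.

Lemma hpart_is_additive d : additive (hpart d).
Proof.
move=> p q; apply/mpolyP => m; rewrite mcoeffB !mcoeff_hpart mcoeffB.
by case: ifP; rewrite ?subr0.
Qed.

HB.instance Definition _ d :=
  GRing.isAdditive.Build R R (hpart d) (@hpart_is_additive d).

Lemma hpart_mulr d e p q : homogeneous_of_degree e q ->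
  hpart d (p * q) = hpart (d - e) p * q.
Proof.
move=> hq; apply/mpolyP => m; rewrite mcoeff_hpart !mcoeffM.
rewrite -[LHS](_ : \sum_(k : 'X_{1..n < (mdeg m).+1, (mdeg m).+1} | m == (k.1 + k.2)%MM)
   (if (mdeg m)%:Z == d then p@_k.1 * q@_k.2 else 0) = _); last first.
  by case: ifP => // _; rewrite big1.
apply: eq_bigr => k /eqP mk; rewrite mcoeff_hpart.
have [->|/(hom_coeff hq) <-] := eqVneq q@_(k.2) 0; first by rewrite !mulr0 if_same.
have -> : ((mdeg m)%:Z == d) = ((mdeg k.1)%:Z == d - (mdeg k.2)%:Z).
  by rewrite {1}mk mdegD PoszD eq_sym -subr_eq eq_sym.
by case: ifP; rewrite ?mul0r.
Qed.

Lemma hom_const d p : homogeneous_of_degree d p -> p@_0 != 0 -> d = 0.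
Proof. by move=> hp /(hom_coeff hp) <-; rewrite mdeg0. Qed.

Section Matrices.
Variables a b : nat.
Variables (g : 'I_a -> int) (g' : 'I_b -> int).

Definition hom_part_mx (M : 'M[R]_(a, b)) := \matrix_(i, j) hpart (g i - g' j) (M i j).
Definition hom_mx (M : 'M[R]_(a, b)) :=
  forall i j, homogeneous_of_degree (g i - g' j) (M i j).

Lemma hom_hom_part_mx M : hom_mx (hom_part_mx M).
Proof. by move=> i j; rewrite mxE; apply: hom_hpart. Qed.

Lemma hom_part_mx_id M : hom_mx M -> hom_part_mx M = M.
Proof. by move=> hM; apply/matrixP=> i j; rewrite mxE hpart_id. Qed.

End Matrices.

Lemma hom_part_mx_mul a b c (g : 'I_a -> int) (g' : 'I_b -> int) (g'' : 'I_c -> int) M N :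
  hom_mx g' g'' N -> hom_part_mx g g'' (M *m N) = hom_part_mx g g' M *m N.
Proof.
move=> hN; apply/matrixP=> i k; rewrite !mxE raddf_sum; apply: eq_bigr => j _ /=.
rewrite (hpart_mulr _ _ (hN j k)) !mxE; congr (hpart _ _ * _); ring.
Qed.

Lemma hom_mul a b c (g : 'I_a -> int) (g' : 'I_b -> int) (g'' : 'I_c -> int) M N :
  hom_mx g g' M -> hom_mx g' g'' N -> hom_mx g g'' (M *m N).
Proof.
move=> hM hN; rewrite -(hom_part_mx_id hM) -(hom_part_mx_mul _ _ hN); exact: hom_hom_part_mx.
Qed.

End HomogeneousParts.

(** * Comparison of graded free resolutions *)

Section Comparison.
Variables (K : fieldType) (n : nat).
Local Notation R := {mpoly K[n]}.
Variable I : R -> Prop.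

Record graded_ideal : Prop := GradedIdeal {
  ideal0 : I 0;
  idealD : forall p q, I p -> I q -> I (p + q);
  idealM : forall a p, I p -> I (a * p);
  ideal_hpart : forall d p, I p -> I (hpart d p)
}.

Hypothesis gI : graded_ideal.
Local Notation res := (graded_free_resolution I).

Lemma idealB p q : I p -> I q -> I (p - q).
Proof. by move=> Ip Iq; apply: idealD => //; rewrite -mulN1r; apply: (idealM gI). Qed.

Lemma ideal_sum (T : finType) (f : T -> R) : (forall i, I (f i)) -> I (\sum_i f i).
Proof.
move=> If; apply: big_ind => //; [exact: ideal0 | exact: idealD].
Qed.

(** Treating the kernel of the augmentation and the kernels of the differentials
alike lets the comparison be built by a single induction. *)
Definition syzygy (F : res) i : 'rV[R]_(rk F i) -> Prop :=
  match i with
  | 0 => fun u => I ((u *m aug F) 0 0)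
  | i'.+1 => fun u => u *m diff F i' = 0
  end.

Lemma syzygyP (F : res) i (u : 'rV[R]_(rk F i)) :
  syzygy u <-> exists v, u = v *m diff F i.
Proof. by case: i u => [|i] u; [apply: exact_aug | apply: exact_diff]. Qed.

Lemma diff_diff (F : res) i : diff F i.+1 *m diff F i = 0.
Proof.
apply/row_matrixP=> a; rewrite row_mul row0; apply/exact_diff.
by exists (delta_mx 0 a); rewrite rowE.
Qed.

Lemma homogeneous_diff (F : res) i : hom_mx (gdeg (g := F) (i := i.+1)) (gdeg (i := i)) (diff F i).
Proof. by move=> a b; apply: diff_homogeneous. Qed.

(** Freeness of the source and exactness of the target; passing to homogeneous
parts keeps the factorisation graded. *)
Lemma factor_diff (F : res) i r (g : 'I_r -> int) (M : 'M[R]_(r, rk F i)) :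
  hom_mx g (gdeg (i := i)) M -> (forall a, syzygy (row a M)) ->
  exists2 N : 'M[R]_(r, rk F i.+1), hom_mx g (gdeg (i := i.+1)) N & M = N *m diff F i.
Proof.
move=> hM zM; have /choice[f fE] a : exists v, row a M = v *m diff F i by apply/syzygyP.
exists (hom_part_mx g (gdeg (i := i.+1)) (\matrix_a f a)); first exact: hom_hom_part_mx.
rewrite -(hom_part_mx_mul _ _ (@homogeneous_diff F i)) -[LHS](hom_part_mx_id hM); congr hom_part_mx.
by apply/row_matrixP=> a; rewrite row_mul rowK.
Qed.

(** One degree of a homotopy equivalence: maps phi, psi in both directions and a
homotopy h from the identity to their composite. Apart from
homogeneity its clauses bear on syzygies only: this determines the next stage
from this one, without any reference to the previous ones. *)
Definition stage (F G : res) i (phi : 'M[R]_(rk F i, rk G i))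
    (psi : 'M[R]_(rk G i, rk F i)) (h : 'M[R]_(rk F i, rk F i.+1)) :=
  [/\ hom_mx (gdeg (i := i)) (gdeg (i := i)) phi /\
      hom_mx (gdeg (i := i)) (gdeg (i := i)) psi,
      hom_mx (gdeg (i := i)) (gdeg (i := i.+1)) h,
      forall u, syzygy u -> syzygy (u *m phi),
      forall u, syzygy u -> syzygy (u *m psi)
    & forall u, syzygy u -> u *m (phi *m psi - 1%:M) = u *m h *m diff F i].

Lemma hom_mxB a b (g : 'I_a -> int) (g' : 'I_b -> int) (M N : 'M[R]_(a, b)) :
  hom_mx g g' M -> hom_mx g g' N -> hom_mx g g' (M - N).
Proof.
move=> hM hN; rewrite -(hom_part_mx_id hM) -(hom_part_mx_id hN).
have -> : hom_part_mx g g' M - hom_part_mx g g' N = hom_part_mx g g' (M - N).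
  by apply/matrixP=> i j; rewrite !mxE raddfB.
exact: hom_hom_part_mx.
Qed.

Lemma hom_mx1 a (g : 'I_a -> int) : hom_mx g g (1%:M : 'M[R]_a).
Proof.
move=> i j m; rewrite mxE mcoeff_msupp; case: (i =P j) => [->|_] /=; last by rewrite mcoeff0 eqxx.
by rewrite mcoeff1; case: (m =P 0%MM) => [->|_]; rewrite ?eqxx // subrr mdeg0.
Qed.

Lemma lift_aug (F G : res) : exists phi : 'M[R]_(rk F 0, rk G 0),
  hom_mx (gdeg (i := 0)) (gdeg (i := 0)) phi /\
  forall u : 'rV_(rk F 0), I ((u *m phi *m aug G) 0 0 - (u *m aug F) 0 0).
Proof.
have /choice[f fE] : forall a, exists v : 'rV_(rk G 0), I (aug F a 0 - (v *m aug G) 0 0).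
  by move=> a; apply: (aug_surjective G (aug F a 0)).
exists (hom_part_mx (gdeg (i := 0)) (gdeg (i := 0)) (\matrix_a f a)); split; first exact: hom_hom_part_mx.
move=> u; rewrite -mulmxA -(@hom_part_mx_mul _ _ _ _ _ _ _ (fun=> 0)); last first.
  by move=> a b; rewrite subr0 ord1; apply: aug_homogeneous.
rewrite !mxE -sumrB.
apply: ideal_sum => a; rewrite -mulrBr; apply: (idealM gI).
have -> : aug F a 0 = hpart (gdeg a - 0) (aug F a 0).
  by rewrite subr0 hpart_id //; apply: aug_homogeneous.
rewrite mxE -raddfB; apply: (ideal_hpart gI) => //; rewrite -opprB -mulN1r; apply: (idealM gI) => //.
have := fE a; congr (I (_ - _)); rewrite [RHS]mxE mxE; apply: eq_bigr => b _.
by rewrite !mxE.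
Qed.

Lemma stage0 (F G : res) : exists phi psi h,
  @stage F G 0 phi psi h /\ phi *m psi - 1%:M = h *m diff F 0.
Proof.
have [phi [hphi phiE]] := lift_aug F G; have [psi [hpsi psiE]] := lift_aug G F.
have [|a|h hh hE] := @factor_diff F 0 _ (gdeg (i := 0)) (phi *m psi - 1%:M).
- by apply: hom_mxB; [exact: hom_mul hphi hpsi | exact: hom_mx1].
- have := idealD gI (psiE (row a phi)) (phiE (row a 1%:M)).
  rewrite -[row a 1%:M *m phi]row_mul mul1mx addrA subrK /=.
  by rewrite raddfB /= row_mul mulmxBl [X in _ -> I X]mxE [X in _ -> I (_ + X)]mxE.
exists phi, psi, h; split=> //; split=> // u Zu.
- have := idealD gI (phiE u) Zu; by rewrite subrK.
- have := idealD gI (psiE u) Zu; by rewrite subrK.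
- by rewrite hE mulmxA.
Qed.

Lemma row_syzygy (F : res) i r (N : 'M[R]_(r, rk F i.+1)) a : syzygy (row a (N *m diff F i)).
Proof. by apply/syzygyP; exists (row a N); rewrite row_mul. Qed.

Lemma stageS (F G : res) i phi psi h : @stage F G i phi psi h -> exists phi' psi' h',
  [/\ @stage F G i.+1 phi' psi' h',
      diff F i *m phi = phi' *m diff G i,
      diff G i *m psi = psi' *m diff F i
    & phi' *m psi' - 1%:M = diff F i *m h + h' *m diff F i.+1].
Proof.
move=> [[hphi hpsi] hh zphi zpsi hE].
have hF := @homogeneous_diff F i; have hG := @homogeneous_diff G i.
have zF a : syzygy (row a (diff F i)) by rewrite -[diff F i]mul1mx; apply: row_syzygy.
have zG a : syzygy (row a (diff G i)) by rewrite -[diff G i]mul1mx; apply: row_syzygy.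
have [a|phi' hphi' phi'E] := factor_diff (hom_mul hF hphi).
  by rewrite row_mul; apply: zphi.
have [a|psi' hpsi' psi'E] := factor_diff (hom_mul hG hpsi).
  by rewrite row_mul; apply: zpsi.
have [||h' hh' h'E] := @factor_diff F i.+1 _ (gdeg (i := i.+1))
    (phi' *m psi' - 1%:M - diff F i *m h).
- apply: hom_mxB; last exact: hom_mul hF hh.
  by apply: hom_mxB; [exact: hom_mul hphi' hpsi' | exact: hom_mx1].
- move=> a /=; rewrite -row_mul !mulmxBl mul1mx -[phi' *m psi' *m _]mulmxA -psi'E.
  rewrite mulmxA -phi'E.
  suff -> : diff F i *m h *m diff F i = diff F i *m (phi *m psi - 1%:M).
    by rewrite mulmxBr mulmx1 mulmxA subrr row0.
  by apply/row_matrixP=> b; rewrite !row_mul hE.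
exists phi', psi', h'; split=> //; last by rewrite -h'E [RHS]addrC subrK.
split=> // u /= Zu.
- by rewrite -mulmxA -phi'E mulmxA Zu mul0mx.
- by rewrite -mulmxA -psi'E mulmxA Zu mul0mx.
- rewrite -[X in u *m X](subrK (diff F i *m h)) h'E mulmxDr [X in _ + X]mulmxA Zu mul0mx.
  by rewrite addr0 mulmxA.
Qed.

Lemma stage_exists (F G : res) i : exists phi psi h, @stage F G i phi psi h.
Proof.
elim: i => [|i [phi [psi [h /stageS[phi' [psi' [h' [st _ _ _]]]]]]]].
  by have [phi [psi [h [st _]]]] := stage0 F G; exists phi, psi, h.
by exists phi', psi', h'.
Qed.

Definition tor_cycle (F : res) i : 'rV[K]_(rk F i) -> Prop :=
  match i with
  | 0 => fun=> True
  | i'.+1 => fun z => z *m diffK F i' = 0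
  end.

Definition tor_nonzero (F : res) i (j : int) := exists z : 'rV[K]_(rk F i),
  [/\ forall a, z 0 a != 0 -> gdeg a = j, tor_cycle z
    & ~ exists w, z = w *m diffK F i].

Local Notation bar := (map_mx (mcoeff 0%MM)).

Lemma bar_mul a b c (M : 'M[R]_(a, b)) (N : 'M[R]_(b, c)) : bar (M *m N) = bar M *m bar N.
Proof. exact: map_mxM. Qed.

Lemma strand_mul a b (g : 'I_a -> int) (g' : 'I_b -> int) (M : 'M[R]_(a, b)) (z : 'rV[K]_a) j :
  hom_mx g g' M -> (forall i, z 0 i != 0 -> g i = j) ->
  forall i, (z *m bar M) 0 i != 0 -> g' i = j.
Proof.
move=> hM zj i; rewrite mxE; apply: contra_neq_eq => gi.
apply: big1 => k _; rewrite mxE.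
have [->|/zj gk] := eqVneq (z 0 k) 0; first by rewrite mul0r.
have [->|/(hom_const (hM k i))/eqP] := eqVneq (M k i)@_0 0; first by rewrite mulr0.
by rewrite subr_eq0 gk eq_sym (negPf gi).
Qed.

(** Modulo the variables phi maps a cycle that is not a boundary to another one:
were this image a boundary, psi would map it to a boundary, which differs from
the original cycle by a boundary. *)
Lemma tor_nonzero_transfer (F G : res) i j : tor_nonzero F i j -> tor_nonzero G i j.
Proof.
case: i => [|i] [z [zj zc znb]].
  have [phi [psi [h [st e]]]] := stage0 F G.
  have [_ [psi' [_ [_ _ psiE _]]]] := stageS st.
  have [[hphi _] _ _ _ _] := st.
  exists (z *m bar phi); split=> //; first exact: strand_mul hphi zj.
  case=> w zw; apply: znb; exists (w *m bar psi' - z *m bar h).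
  move/(congr1 bar): e; rewrite map_mxB map_mx1 !bar_mul => e.
  rewrite mulmxBl -!mulmxA -[diffK F 0]/(bar _) -e -[bar psi' *m _]bar_mul -psiE bar_mul.
  by rewrite [X in X - _]mulmxA -[bar (diff G 0)]/(diffK G 0) -zw mulmxBr mulmx1 mulmxA opprB addrC subrK.
have [phi0 [psi0 [h0 st0]]] := stage_exists F G i.
have [phi [psi [h [st phiE psiE e]]]] := stageS st0.
have [_ [psi' [_ [_ _ psi'E _]]]] := stageS st.
have [[hphi _] _ _ _ _] := st.
exists (z *m bar phi); split; first exact: strand_mul hphi zj.
  rewrite /= -mulmxA -[diffK G i]/(bar _) -bar_mul -phiE bar_mul mulmxA.
  by move: zc => /= ->; rewrite mul0mx.
case=> w zw; apply: znb; exists (w *m bar psi' - z *m bar h).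
move/(congr1 bar): e; rewrite map_mxB map_mx1 map_mxD !bar_mul => e.
have {e}/(congr1 (mulmx z)) := e.
have zc0 : z *m diffK F i = 0 := zc.
rewrite mulmxBr mulmx1 mulmxDr -[bar (diff F i)]/(diffK F i) [z *m (diffK F i *m _)]mulmxA zc0 mul0mx add0r.
rewrite mulmxBl -!mulmxA -[diffK F i.+1]/(bar _) => <-.
rewrite -[bar psi' *m _]bar_mul -psi'E bar_mul.
by rewrite [X in X - _]mulmxA -[bar (diff G i.+1)]/(diffK G i.+1) -zw mulmxA opprB addrC subrK.
Qed.

Lemma diffK_diffK (F : res) i : diffK F i.+1 *m diffK F i = 0.
Proof. by rewrite -bar_mul diff_diff map_mx0. Qed.

Lemma strandE (F : res) i j (z : 'rV[K]_(rk F i)) a :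
  (z *m strand F i j) 0 a = if gdeg a == j then z 0 a else 0.
Proof. by rewrite mul_mx_diag !mxE; case: eqP; rewrite ?mulr1 ?mulr0. Qed.

Lemma strandP (F : res) i j (z : 'rV[K]_(rk F i)) :
  (z <= strand F i j)%MS <-> forall a, z 0 a != 0 -> gdeg a = j.
Proof.
split=> [/submxP[w ->] a|zj].
  by rewrite strandE; case: (gdeg a =P j) => // _ /eqP.
apply/submxP; exists z; apply/rowP=> a; rewrite strandE; case: eqP => // ne.
by apply/eqP; apply: contra_notT ne; apply: zj.
Qed.

Lemma boundary_strand (F : res) i j (w : 'rV[K]_(rk F i.+1)) :
  (forall a, (w *m diffK F i) 0 a != 0 -> gdeg a = j) ->
  w *m diffK F i = w *m strand F i.+1 j *m diffK F i.
Proof.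
move=> wj; apply/rowP=> a.
have hd := @strand_mul _ _ _ _ _ (w *m strand F i.+1 j) j (@homogeneous_diff F i).
have wsj : forall b, (w *m strand F i.+1 j) 0 b != 0 -> gdeg b = j by apply/strandP/submxMl.
have [aj|aj] := eqVneq (gdeg a) j; last first.
  rewrite [LHS](_ : _ = 0) ?[RHS](_ : _ = 0) //; apply/eqP; apply: contraNT aj.
    by move=> /(hd wsj) ->.
  by move=> /wj ->.
rewrite mxE [RHS]mxE; apply: eq_bigr => b _; rewrite strandE; case: eqP => // bj.
rewrite mul0r mxE.
have [->|/(hom_const (@homogeneous_diff F i b a))/eqP] := eqVneq ((diff F i) b a)@_0 0.
  by rewrite mulr0.
by rewrite subr_eq0 aj => /eqP.
Qed.

Lemma tor_cyclesP (F : res) i j (z : 'rV[K]_(rk F i)) :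
  (z <= tor_cycles F i j)%MS <-> (forall a, z 0 a != 0 -> gdeg a = j) /\ tor_cycle z.
Proof.
case: i z => [|i] z /=; first by split=> [/strandP|[/strandP]].
rewrite sub_capmx; split=> [/andP[/strandP ? /sub_kermxP]//|[/strandP -> zc]].
exact/sub_kermxP.
Qed.

Lemma tor_boundariesP (F : res) i j (z : 'rV[K]_(rk F i)) :
  (z <= tor_boundaries F i j)%MS <->
  (forall a, z 0 a != 0 -> gdeg a = j) /\ exists w, z = w *m diffK F i.
Proof.
rewrite /tor_boundaries; split=> [/submxP[w ->]|[zj [w zw]]].
  split; last by exists (w *m strand F i.+1 j); rewrite mulmxA.
  rewrite mulmxA; apply: strand_mul (@homogeneous_diff F i) _.
  exact/strandP/submxMl.
by apply/submxP; exists w; rewrite mulmxA -boundary_strand // -zw.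
Qed.

Lemma tor_dim_nonzero (F : res) i j : tor_dim F i j <> 0%N <-> tor_nonzero F i j.
Proof.
have bc : (tor_boundaries F i j <= tor_cycles F i j)%MS.
  apply/row_subP=> a; apply/tor_cyclesP.
  have /tor_boundariesP[zj [w zw]] := row_sub a (tor_boundaries F i j).
  split=> //; case: i w a zw {zj} => //= i w a ->.
  by rewrite -mulmxA diffK_diffK mulmx0.
have -> : (tor_dim F i j <> 0%N) <-> ~ (tor_cycles F i j <= tor_boundaries F i j)%MS.
  rewrite /tor_dim -(mxrank_leqif_sup bc) eqn_leq mxrankS //= -subn_eq0.
  by split=> h e; apply: h; apply/eqP.
split=> [/negP/row_subPn[a na]|[z [zj zc znb]] cb].
  have /tor_cyclesP[zj zc] := row_sub a (tor_cycles F i j).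
  exists (row a (tor_cycles F i j)); split=> // zb; move/negP: na; apply.
  exact/tor_boundariesP.
have /tor_cyclesP zcy := conj zj zc.
by have /tor_boundariesP[_] := submx_trans zcy cb.
Qed.

(** Only the nonvanishing of Betti numbers is compared: maxima over their support
ask for no more. *)
Lemma betti_nonzero (F : res) i j : betti I i j <> 0%N <-> tor_nonzero F i j.
Proof.
rewrite /betti; case: classical_sets.xgetP => [b -> [G <-]|/(_ (tor_dim F i j)) []]; last by exists F.
by rewrite tor_dim_nonzero; split; apply: tor_nonzero_transfer.
Qed.

End Comparison.

(** * Division by a variable *)

Section DivideByVariable.
Variables (K : fieldType) (n : nat).
Local Notation R := {mpoly K[n]}.
Implicit Types (p q : R) (m : 'X_{1..n}) (v u : 'I_n).

Definition divX v p : R :=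
  \sum_(m <- msupp p | (0 < m v)%N) p@_m *: 'X_[m - U_(v)].

Lemma lepU v m : (U_(v) <= m)%MM = (0 < m v)%N.
Proof.
apply/mnm_lepP/idP => [/(_ v)|mv i]; rewrite mnm1E ?eqxx //.
by case: eqP => // <-.
Qed.

Lemma mcoeff_divX v p m : (divX v p)@_m = p@_(m + U_(v)).
Proof.
rewrite /divX raddf_sum /=.
rewrite (eq_bigr (fun i => if i == (m + U_(v))%MM then p@_(m + U_(v)) else 0)); last first.
  move=> i iv; rewrite mcoeffZ mcoeffX.
  have -> : ((i - U_(v))%MM == m) = (i == (m + U_(v))%MM).
    by apply/eqP/eqP=> [<-|->]; rewrite ?addmK // submK // lepU.
  by case: eqP => [->|_]; rewrite ?mulr1 ?mulr0.
rewrite -big_mkcondr (eq_bigl (fun i => i == (m + U_(v))%MM)); last first.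
  by move=> i; rewrite andbC; case: eqP => // ->; rewrite mnmDE mnm1E eqxx addn1.
have [mp|/memN_msupp_eq0 pm0] := boolP ((m + U_(v))%MM \in msupp p); last first.
  by rewrite pm0 big1.
by rewrite -big_filter filter_pred1_uniq ?msupp_uniq // big_seq1.
Qed.

Lemma divX_is_additive v : additive (divX v).
Proof. by move=> p q; apply/mpolyP => m; rewrite mcoeffB !mcoeff_divX mcoeffB. Qed.

HB.instance Definition _ v :=
  GRing.isAdditive.Build R R (divX v) (@divX_is_additive v).

Lemma mcoeff_mulX v p m : ('X_v * p)@_m = if (0 < m v)%N then p@_(m - U_(v)) else 0.
Proof.
rewrite mulrC; case: ifPn => mv.
  by rewrite -{1}(@submK _ U_(v)%MM m) ?lepU // addmC mcoeffMX.
apply: memN_msupp_eq0; rewrite (perm_mem (msuppMX p U_(v))).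
by apply: contra mv => /mapP[k _ ->]; rewrite mnmDE mnm1E eqxx.
Qed.

Lemma divX_mulX v p : divX v ('X_v * p) = p.
Proof.
by apply/mpolyP => m; rewrite mcoeff_divX mcoeff_mulX mnmDE mnm1E eqxx addn1 addmK.
Qed.

Lemma divX_mulX_neq v u p : u != v -> divX v ('X_u * p) = 'X_u * divX v p.
Proof.
move=> uv; apply/mpolyP => m; rewrite mcoeff_divX !mcoeff_mulX mcoeff_divX mnmDE mnm1E.
rewrite eq_sym (negPf uv) addn0; case: ifP => // mu; congr (p@_ _).
apply/mnmP => i; rewrite !(mnmDE, mnmBE) !mnm1E.
by case: (eqVneq u i) => [<-|_]; rewrite ?subn0 // eq_sym (negPf uv) !addn0.
Qed.

Lemma divX_sg v u (S : {set 'I_n}) p : divX v (sg u S * p) = sg u S * divX v p.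
Proof. by rewrite /sg -signr_odd !mulr_sign; case: ifP => // _; rewrite raddfN. Qed.

Definition dropX v p : R := mfilter (fun m => m v == 0%N) p.

Lemma mulX_divX v p : 'X_v * divX v p = p - dropX v p.
Proof.
apply/mpolyP => m; rewrite mcoeff_mulX mcoeffB mcoeff_mfilter mcoeff_divX.
case: posnP => mv; first by rewrite subrr.
by rewrite submK ?lepU // subr0.
Qed.

End DivideByVariable.

(** * The Koszul complex on a set of variables *)

Section Koszul.
Variables (K : fieldType) (n : nat) (V : {set 'I_n}).
Local Notation R := {mpoly K[n]}.
Local Notation T := {set 'I_n}.
Implicit Types (g h : T -> R) (S : T) (v u : 'I_n).

Definition koszul g S : R := \sum_(v in V | v \notin S) sg v S * ('X_v * g (v |: S)).

Lemma eq_koszul g h S : (forall S', g S' = h S') -> koszul g S = koszul h S.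
Proof. by move=> e; apply: eq_bigr => v _; rewrite e. Qed.

Lemma koszulB g h S : koszul (fun S' => g S' - h S') S = koszul g S - koszul h S.
Proof. by rewrite /koszul -sumrB; apply: eq_bigr => v _; rewrite !mulrBr. Qed.

Lemma koszulD g h S : koszul (fun S' => g S' + h S') S = koszul g S + koszul h S.
Proof. by rewrite /koszul -big_split; apply: eq_bigr => v _; rewrite !mulrDr. Qed.

Lemma koszul_koszul g S : koszul (koszul g) S = 0.
Proof.
rewrite -[RHS](@sum_sg_antisym _ _ V S (fun v u => 'X_v * ('X_u * g (u |: (v |: S))))).
  apply: eq_bigr => v _; rewrite /koszul !big_distrr /=.
  by apply: eq_bigr => u _; ring.
by move=> u v _ _ _; rewrite mulrCA setUCA.
Qed.

Definition koszul_chain k g := forall S, ~~ ((S \subset V) && (#|S| == k)) -> g S = 0.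

Definition koszul_homotopy v g S : R := if v \in S then sg v S * divX v (g (S :\ v)) else 0.

Definition kill_var v g S : R := if v \in S then 0 else dropX v (g S).

(** Division by a single variable v of V contracts the Koszul complex onto the
part where v occurs neither in the set nor in the coefficients. *)
Lemma koszul_homotopyE v g S : v \in V ->
  koszul (koszul_homotopy v g) S + koszul_homotopy v (koszul g) S = g S - kill_var v g S.
Proof.
move=> vV; rewrite {2}/koszul_homotopy /kill_var; case: ifPn => vS; last first.
  rewrite addr0 -mulX_divX /koszul (bigD1 v) /= ?vV // big1 ?addr0.
    by rewrite /koszul_homotopy !inE eqxx /= setU1K // sg_self [LHS]mulrCA [sg v S * (_ * _)]mulrA sg_sq mul1r.
  move=> u /andP[_ uv]; rewrite /koszul_homotopy !inE eq_sym (negPf uv) (negPf vS) /=.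
  by rewrite !mulr0.
have [S' vS' ->] : exists2 S' : {set 'I_n}, v \notin S' & S = v |: S'.
  by exists (S :\ v); rewrite ?setD1K // !inE eqxx.
rewrite setU1K // subr0 [X in divX _ X]/koszul (bigD1 v) /= ?vV // raddfD mulrDr /=.
rewrite divX_sg divX_mulX mulrA sg_self sg_sq mul1r addrCA -[RHS]addr0; congr (_ + _).
rewrite /koszul raddf_sum big_distrr /=.
rewrite [X in _ + X](eq_bigl (fun u => (u \in V) && (u \notin v |: S'))); last first.
  by move=> u; rewrite !inE negb_or; case: (u == v); rewrite ?andbF ?andbT.
rewrite -big_split big1 // => u /andP[uV]; rewrite !inE negb_or => /andP[uv uS'] /=.
rewrite divX_sg divX_mulX_neq // /koszul_homotopy !inE eqxx orbT.
have -> : (u |: (v |: S')) :\ v = u |: S' by rewrite setUCA setU1K // !inE negb_or eq_sym uv.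
have -> : sg v (u |: (v |: S')) = sg v (u |: S') :> R by rewrite setUCA sg_self.
rewrite !sgU1 //; have : (v < u)%N || (u < v)%N by rewrite -neq_ltn eq_sym.
by case: ltngtP => // _ _; ring.
Qed.

Lemma koszul_chain_homotopy v k g : v \in V -> koszul_chain k g -> koszul_chain k.+1 (koszul_homotopy v g).
Proof.
move=> vV cg S; rewrite /koszul_homotopy; case: ifP => // vS.
apply: contraNeq => ne; rewrite -{1}(setD1K vS) subUset sub1set vV /=.
rewrite (cardsD1 v S) vS eqSS; apply: contraR ne => /cg ->.
by rewrite raddf0 mulr0.
Qed.

Lemma koszul_chain_kill v k g : koszul_chain k g -> koszul_chain k (kill_var v g).
Proof.
move=> cg S /cg gS; rewrite /kill_var gS; case: ifP => // _.
by apply/mpolyP => m; rewrite mcoeff_mfilter mcoeff0 if_same.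
Qed.

Lemma koszul_kill (s : seq 'I_n) k g : {subset s <= V} -> koszul_chain k g ->
  (forall S, koszul g S = 0) ->
  exists h, koszul_chain k.+1 h /\
   forall S m, (g S - koszul h S)@_m =
     if all (fun v => (v \notin S) && (m v == 0%N)) s then (g S)@_m else 0.
Proof.
elim: s g => [|v s IHs] g sV cg zg.
  exists (fun=> 0); split=> // S m; rewrite /koszul big1 ?subr0 //.
  by move=> u _; rewrite !mulr0.
have vV : v \in V by apply: sV; rewrite mem_head.
have gE S : g S - koszul (koszul_homotopy v g) S = kill_var v g S.
  have := koszul_homotopyE g S vV; rewrite [koszul_homotopy v (koszul g) S](_ : _ = 0) ?addr0.
    by move=> ->; rewrite subKr.
  by rewrite /koszul_homotopy zg raddf0 mulr0 if_same.
have [||h [ch hE]] := IHs (kill_var v g) _ (koszul_chain_kill v cg).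
- by move=> u us; apply: sV; rewrite inE us orbT.
- by move=> S; rewrite -(eq_koszul _ gE) koszulB zg koszul_koszul subrr.
exists (fun S => koszul_homotopy v g S + h S); split=> [S Sk|S m].
  by rewrite (koszul_chain_homotopy vV cg) // ch // addr0.
rewrite koszulD opprD addrA gE hE /= /kill_var.
case: (v \in S) => /=; first by rewrite mcoeff0 if_same.
by rewrite mcoeff_mfilter; case: (m v == 0%N) => //; rewrite if_same.
Qed.

(** After all the variables of V have been killed, only the monomials free of V
in degree 0 are left. *)
Lemma koszul_exact k g : koszul_chain k g -> (forall S, koszul g S = 0) ->
  (forall m : 'X_{1..n}, (forall v, v \in V -> m v = 0%N) -> (g set0)@_m = 0) ->
  exists2 h, koszul_chain k.+1 h & forall S, g S = koszul h S.
Proof.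
move=> cg zg g0.
have [|h [ch hE]] := @koszul_kill (enum V) k g _ cg zg; first by move=> v; rewrite mem_enum.
exists h => // S; apply/eqP; rewrite -subr_eq0; apply/eqP/mpolyP => m.
rewrite hE mcoeff0; case: ifP => // /allP all0.
have [SV|SV] := boolP (S \subset V); last by rewrite cg ?(negPf SV) // mcoeff0.
have S0 : S = set0.
  apply/setP=> v; rewrite inE; apply/negP => vS.
  by have := all0 v; rewrite mem_enum (subsetP SV) // vS => /(_ isT).
rewrite S0 g0 // => v vV.
by have := all0 v; rewrite mem_enum vV => /(_ isT) /andP[_ /eqP].
Qed.

End Koszul.

(** * Free modules indexed by a finite set *)

Section IndexedVectors.
Variables (A : comNzRingType) (T : finType).

Section Defs.
Variable B : {set T}.
Definition coords (u : 'rV[A]_#|B|) (x : T) : A :=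
  \sum_a if enum_val a == x then u 0 a else 0.
Definition vec (f : T -> A) : 'rV[A]_#|B| := \row_a f (enum_val a).

Lemma coords_val u a : coords u (enum_val a) = u 0 a.
Proof.
rewrite /coords (bigD1 a) //= eqxx big1 ?addr0 // => b ba.
by rewrite (inj_eq enum_val_inj) (negPf ba).
Qed.

Lemma coords_out u x : x \notin B -> coords u x = 0.
Proof.
move=> xB; apply: big1 => a _; case: eqP => // ax.
by case/negP: xB; rewrite -ax enum_valP.
Qed.

Lemma coords_vec f x : coords (vec f) x = if x \in B then f x else 0.
Proof.
case: ifPn => [xB|]; last exact: coords_out.
by rewrite -(enum_rankK_in xB xB) coords_val mxE.
Qed.

Lemma vecP u w : (forall x, x \in B -> coords u x = coords w x) -> u = w.
Proof. by move=> e; apply/rowP=> a; rewrite -!coords_val e // enum_valP. Qed.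

End Defs.

Lemma mulmx_coords (B : {set T}) r (u : 'rV[A]_#|B|) (f : T -> 'I_r -> A) b :
  (u *m \matrix_(a, b) f (enum_val a) b) 0 b = \sum_x coords u x * f x b.
Proof.
rewrite mxE [RHS](bigID (mem B)) /= [X in _ + X]big1 ?addr0; last first.
  by move=> x /coords_out->; rewrite mul0r.
by rewrite [RHS]big_enum_val; apply: eq_bigr => a _; rewrite mxE coords_val.
Qed.

End IndexedVectors.

(** * The complex of pairs of a face and a disjoint set *)

Section FaceComplex.
Variables (n : nat) (Y : {set 'I_n}) (D : {set {set 'I_n}}).
Hypotheses (dD : down_closed D) (DY : faces_in Y D).
Local Notation V := {set 'I_n}.
Implicit Types (F S : V) (v u : 'I_n).

Definition cells (i : nat) : {set V * V} :=
  [set x : V * V | [&& x.1 \in D, x.2 \subset Y :\: x.1 & #|x.2| == i]].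

Lemma in_cells i F S : (F, S) \in cells i = [&& F \in D, S \subset Y :\: F & #|S| == i].
Proof. by rewrite inE. Qed.

Section Differential.
Variables (A : comNzRingType) (y : 'I_n -> A).
Implicit Types (f h : V -> V -> A) (g : V -> A).

(** The effect of a vertex v removed from S: it is added to F (so that the value
at F comes from F minus v), or multiplies by - y v. The elements y are the
variables for the resolution, and 0 for its reduction modulo the variables. *)
Definition act v g F : A := if v \in F then g (F :\ v) else - y v * g F.

Definition bd f F S : A := \sum_(v | v \notin S) sg v S * act v (f^~ (v |: S)) F.

Definition cell_entry (x z : V * V) : A :=
  \sum_(v in x.2 | z.2 == x.2 :\ v)
    sg v z.2 * ((z.1 == v |: x.1)%:R - y v * (z.1 == x.1)%:R).

Definition cell_chain i f := forall F S, (F, S) \notin cells i -> f F S = 0.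

(** On functions supported on the cells the matrix of the differential acts as
[bd]: for each v outside S a single cell contributes. *)
Lemma sum_cell_entry i f F S : cell_chain i f ->
  \sum_x f x.1 x.2 * cell_entry x (F, S) = bd f F S.
Proof.
move=> cf; rewrite /cell_entry.
under eq_bigr => x _ do rewrite big_mkcond big_distrr /=.
rewrite exchange_big /= /bd [RHS]big_mkcond /=; apply: eq_bigr => v _.
case: ifPn => vS; last first.
  apply: big1 => x _; case: ifP => [/andP[_ /eqP Sx]|]; rewrite ?mulr0 //.
  by case/negP: vS; rewrite Sx !inE eqxx.
pose F0 := if v \in F then F :\ v else F.
have xS (x : V * V) : (v \in x.2) && (S == x.2 :\ v) = (x.2 == v |: S).
  apply/andP/eqP=> [[vx /eqP->]|->]; first by rewrite setD1K.
  by rewrite !inE eqxx setU1K.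
rewrite (bigD1 (F0, v |: S)) //= setU11 setU1K // eqxx [X in _ + X]big1 ?addr0; last first.
  move=> [F1 S1]; rewrite xS /= xpair_eqE negb_and; case: (S1 =P v |: S) => [->|_].
    rewrite orbF => F1F0; have [vF1|vF1] := boolP (v \in F1).
      rewrite cf ?mul0r // in_cells; apply: contraL vF1.
      by move=> /and3P[_ /subsetP/(_ v)]; rewrite !inE eqxx => /(_ isT)/andP[].
    rewrite (_ : (F == v |: F1) = false) 1?(_ : (F == F1) = false) ?mulr0 ?subr0 ?mulr0 //.
      apply: contraNF F1F0 => /eqP FF1; rewrite /F0 FF1.
      by rewrite (negPf vF1).
    apply: contraNF F1F0 => /eqP FF1; rewrite /F0 FF1 !inE eqxx /=.
    by rewrite setU1K.
  by rewrite mulr0.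
rewrite mulrCA; congr (_ * _); rewrite /act /F0; case: ifPn => vF.
  rewrite setD1K // eqxx [X in _ * X](_ : _ = 1) ?mulr1 //.
  rewrite (_ : (F == _) = false) ?mulr0 ?subr0 //.
  by apply: contraTF vF => /eqP ->; rewrite !inE eqxx.
rewrite eqxx (_ : (F == _) = false) ?mulr1 ?sub0r ?[- _ * _]mulrC //.
by apply: contraNF vF => /eqP ->; rewrite !inE eqxx.
Qed.

Lemma act_sum v (I : Type) (r : seq I) (P : pred I) (g : I -> V -> A) F :
  act v (fun F' => \sum_(j <- r | P j) g j F') F = \sum_(j <- r | P j) act v (g j) F.
Proof. by rewrite /act; case: ifP; rewrite // big_distrr. Qed.

Lemma actM v a g F : act v (fun F' => a * g F') F = a * act v g F.
Proof. by rewrite /act; case: ifP; rewrite // mulrCA. Qed.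

Lemma act_comm v u g F : u != v -> act v (act u g) F = act u (act v g) F.
Proof.
move=> uv; rewrite /act !inE uv (eq_sym v) uv /=.
case: (v \in F); case: (u \in F) => //=; last by rewrite mulrCA.
by congr (g _); apply/setP=> x; rewrite !inE andbCA.
Qed.

(** The operators [act] commute, so the signs of the exterior algebra cancel the
terms in pairs. *)
Lemma bd_bd f F S : bd (bd f) F S = 0.
Proof.
rewrite -[RHS](@sum_sg_antisym _ _ setT S
  (fun v u => act v (act u (f^~ (u |: (v |: S)))) F)).
  apply: eq_big => v; first by rewrite in_setT.
  move=> vS; rewrite [X in _ * X]act_sum big_distrr /=; apply: eq_big => u.
    by rewrite in_setT.
  by move=> uS; rewrite actM mulrA.
by move=> u v _ _ uv; rewrite setUCA act_comm.
Qed.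

Lemma eq_bd f h F S : F \in D -> (forall F' S', F' \in D -> f F' S' = h F' S') ->
  bd f F S = bd h F S.
Proof.
move=> FD e; apply: eq_bigr => v _; congr (_ * _); rewrite /act.
by case: ifP => _; rewrite e // (dD FD) // subD1set.
Qed.

Lemma bdB f h F S : bd (fun F' S' => f F' S' - h F' S') F S = bd f F S - bd h F S.
Proof.
rewrite /bd -sumrB; apply: eq_bigr => v _; rewrite -mulrBr; congr (_ * _).
by rewrite /act; case: ifP => _ //; rewrite mulrBr.
Qed.

Lemma bdD f h F S : bd (fun F' S' => f F' S' + h F' S') F S = bd f F S + bd h F S.
Proof.
rewrite /bd -big_split; apply: eq_bigr => v _ /=; rewrite -mulrDr; congr (_ * _).
by rewrite /act; case: ifP => _ //; rewrite mulrDr.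
Qed.

(** The differential of a function on cells may be nonzero on sets F that are not
faces but become faces after removing a vertex; these values are discarded. *)
Definition on_faces f F S : A := if F \in D then f F S else 0.

Lemma cell_chain_bd i f : cell_chain i.+1 f -> cell_chain i (on_faces (bd f)).
Proof.
move=> cf F S; rewrite in_cells /on_faces; case: ifP => // FD /=.
apply: contraNeq => ne.
have /existsP[v /andP[vS av]] : [exists v, (v \notin S) && (act v (f^~ (v |: S)) F != 0)].
  apply: contraR ne => /existsPn e; rewrite /bd big1 // => v vS.
  by have := e v; rewrite vS negbK => /eqP ->; rewrite mulr0.
have cS : forall F', (F', v |: S) \in cells i.+1 -> (S \subset Y :\: F') && (#|S| == i).
  move=> F'; rewrite in_cells cardsU1 vS add1n eqSS subUset => /and3P[_ /andP[_ ->] ->].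
  by [].
move: av; rewrite /act; case: ifPn => vF.
  have [/cS/andP[SY ->] _|/cf->] := boolP ((F :\ v, v |: S) \in cells i.+1); last by rewrite eqxx.
  rewrite andbT; apply/subsetP=> x xS; have := subsetP SY x xS; rewrite !inE negb_and negbK.
  by case/andP=> /orP[/eqP xv|->] ->; rewrite // -xv xS in vS.
by have [/cS //|/cf->] := boolP ((F, v |: S) \in cells i.+1); rewrite mulr0 eqxx.
Qed.

Definition dmx i : 'M[A]_(#|cells i.+1|, #|cells i|) :=
  \matrix_(a, b) cell_entry (enum_val a) (enum_val b).

Definition fcoords i (u : 'rV[A]_#|cells i|) F S := coords u (F, S).
Definition fvec i f : 'rV[A]_#|cells i| := vec (cells i) (fun x => f x.1 x.2).

Lemma cell_chain_fcoords i (u : 'rV[A]_#|cells i|) : cell_chain i (fcoords u).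
Proof. by move=> F S; apply: coords_out. Qed.

Lemma fcoords_fvec i f : cell_chain i f -> forall F S, fcoords (fvec i f) F S = f F S.
Proof. by move=> cf F S; rewrite /fcoords coords_vec; case: ifPn => // /cf ->. Qed.

Lemma fcoords_mul i (u : 'rV[A]_#|cells i.+1|) F S :
  fcoords (u *m dmx i) F S = on_faces (bd (fcoords u)) F S.
Proof.
have cu := cell_chain_fcoords u.
have [FS|FS] := boolP ((F, S) \in cells i); last first.
  by rewrite [LHS]coords_out // (cell_chain_bd cu).
rewrite /on_faces; have := FS; rewrite in_cells => /and3P[-> _ _].
rewrite /fcoords -(enum_rankK_in FS FS) coords_val.
rewrite (mulmx_coords u (fun x b => cell_entry x (enum_val b))) (enum_rankK_in FS FS).
by rewrite -(sum_cell_entry F S cu); apply: eq_bigr => -[F' S'] _.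
Qed.

Lemma fcoordsP i (u w : 'rV[A]_#|cells i|) :
  (forall F S, F \in D -> fcoords u F S = fcoords w F S) -> u = w.
Proof. by move=> e; apply: vecP => -[F S]; rewrite in_cells => /and3P[FD _ _]; apply: e. Qed.

Lemma dmx_dmx i (u : 'rV[A]_#|cells i.+2|) : u *m dmx i.+1 *m dmx i = 0.
Proof.
apply: fcoordsP => F S FD; rewrite fcoords_mul /on_faces FD.
rewrite (@eq_bd _ (bd (fcoords u))) ?bd_bd //.
  by rewrite /fcoords /coords big1 // => a _; rewrite mxE if_same.
by move=> F' S' F'D; rewrite fcoords_mul /on_faces F'D.
Qed.

End Differential.
End FaceComplex.

(** * Stanley-Reisner ideals and their resolutions *)

Section Ideal.
Variables (K : fieldType) (n : nat).
Local Notation R := {mpoly K[n]}.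
Local Notation V := {set 'I_n}.
Implicit Types (F S Y : V) (D : {set V}) (p : R) (m : 'X_{1..n}).

Definition indic F : 'X_{1..n} := [multinom (i \in F : nat) | i < n].
Definition supp m : V := [set v | (0 < m v)%N].

Lemma set_monomialE F : set_monomial K F = 'X_[indic F].
Proof.
rewrite /set_monomial (mpolyXE_id K (indic F)) big_mkcond; apply: eq_bigr => i _.
by rewrite mnmE; case: (i \in F).
Qed.

Lemma indic_le F m : (indic F <= m)%MM = (F \subset supp m).
Proof.
apply/mnm_lepP/subsetP => [le i iF|sF i].
  by have := le i; rewrite mnmE iF inE.
by rewrite mnmE; case: (boolP (i \in F)) => // /sF; rewrite inE.
Qed.

Lemma mcoeff_mul_monomial F p m :
  (p * set_monomial K F)@_m = if F \subset supp m then p@_(m - indic F) else 0.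
Proof.
rewrite set_monomialE -indic_le; case: ifPn => le.
  by rewrite -{1}(submK le) addmC mcoeffMX.
apply: memN_msupp_eq0; rewrite (perm_mem (msuppMX p _)).
apply: contra le => /mapP[k _ ->]; apply/mnm_lepP => i.
by rewrite mnmDE leq_addr.
Qed.

Lemma SR_idealP Y D p : down_closed D ->
  SR_ideal Y D p <-> forall m, p@_m != 0 -> supp m :&: Y \notin D.
Proof.
move=> dD; split=> [[c ->] m|pD].
  rewrite raddf_sum /= => ne.
  have /existsP[F /andP[/andP[FY FD]]] : [exists F : V, (F \subset Y) && (F \notin D) &&
      ((c F * set_monomial K F)@_m != 0)].
    apply: contraR ne => /existsPn e; rewrite big1 // => F FYD.
    by have := e F; rewrite FYD negbK => /eqP.
  rewrite mcoeff_mul_monomial; case: ifP; last by rewrite eqxx.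
  by move=> Fm _; apply: contra FD => /dD; apply; rewrite subsetI Fm.
exists (fun F => \sum_(m <- msupp p | supp m :&: Y == F) p@_m *: 'X_[m - indic F]).
rewrite {1}(mpolyE p) big_seq.
rewrite (partition_big (fun m => supp m :&: Y)
  (fun F : V => (F \subset Y) && (F \notin D))) /=; last first.
  by move=> m; rewrite mcoeff_msupp => /pD ->; rewrite subsetIr.
apply: eq_bigr => F /andP[FY FD]; rewrite big_distrl /= [RHS]big_seq_cond.
apply: eq_bigr => m /andP[_ /eqP mF].
rewrite set_monomialE -scalerAl -mpolyXD submK // indic_le -mF; exact: subsetIl.
Qed.

Lemma graded_SR_ideal Y D : down_closed D -> graded_ideal (SR_ideal (K := K) Y D).
Proof.
move=> dD; split=> [|p q|a p|d p].
- by apply/SR_idealP => // m; rewrite mcoeff0 eqxx.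
- move=> /(SR_idealP _ _ dD) pD /(SR_idealP _ _ dD) qD; apply/SR_idealP => // m.
  rewrite mcoeffD; have [->|/pD //] := eqVneq p@_m 0.
  by rewrite add0r => /qD.
- move=> /(SR_idealP _ _ dD) pD; apply/SR_idealP => // m.
  rewrite -mcoeff_msupp => /msuppM_le/allpairsP[[m1 m2] /= [_ m2p ->]].
  rewrite mcoeff_msupp in m2p; apply: contra (pD _ m2p) => /dD; apply.
  by apply: setSI; apply/subsetP=> i; rewrite !inE mnmDE addn_gt0 orbC => ->.
- move=> /(SR_idealP _ _ dD) pD; apply/SR_idealP => // m.
  by rewrite mcoeff_hpart; case: ifP => [_ /pD|_]; rewrite ?eqxx.
Qed.

End Ideal.

Section Resolution.
Variables (K : fieldType) (n : nat) (Y : {set 'I_n}) (D : {set {set 'I_n}}).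
Hypotheses (dD : down_closed D) (DY : faces_in Y D).
Local Notation R := {mpoly K[n]}.
Local Notation V := {set 'I_n}.
Local Notation I := (SR_ideal (K := K) Y D).
Local Notation X := (fun v : 'I_n => 'X_v : R).
Implicit Types (F S : V) (v u : 'I_n) (f h : V -> V -> R).

Definition augf f : R := \sum_F f F set0 * set_monomial K F.

Definition bd_cycle k f : Prop :=
  match k with
  | 0 => I (augf f)
  | _.+1 => forall F S, F \in D -> bd X f F S = 0
  end.

Lemma augfB f h : augf (fun F S => f F S - h F S) = augf f - augf h.
Proof. by rewrite /augf -sumrB; apply: eq_bigr => F _; rewrite mulrBl. Qed.

Lemma mono_setU F v : v \notin F -> set_monomial K (v |: F) = 'X_v * set_monomial K F.
Proof. by move=> vF; rewrite /set_monomial big_setU1. Qed.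

Lemma mono_in_ideal F a : F \subset Y -> F \notin D -> I (a * set_monomial K F).
Proof.
move=> FY FD; apply/SR_idealP => // m; rewrite mcoeff_mul_monomial.
case: ifP; last by rewrite eqxx.
by move=> Fm _; apply: contra FD => /dD; apply; rewrite subsetI Fm.
Qed.

(** In degree 0: both terms of the differential of the cell (F, {v}) are
augmented to the monomial of v |: F, and they cancel unless v |: F is not a face,
in which case that monomial lies in the ideal. *)
Lemma bd_is_cycle k h : cell_chain Y D k.+1 h -> bd_cycle k (on_faces D (bd X h)).
Proof.
move=> ch; case: k ch => [|k] ch /=; last first.
  move=> F S FD; rewrite (eq_bd dD X S FD (h := bd X h)) ?bd_bd //.
  by move=> F' S' F'D; rewrite /on_faces F'D.
have hF F S : F \notin D -> h F S = 0.
  by move=> FD; rewrite ch // in_cells (negPf FD).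
have gI := graded_SR_ideal K Y dD.
have -> : augf (on_faces D (bd X h)) = \sum_(v < n) \sum_(F : V | v \notin F)
   h F [set v] * ((v |: F \in D)%:R - 1) * set_monomial K (v |: F).
  transitivity (\sum_F \sum_v (if F \in D then act X v (h^~ [set v]) F else 0)
      * set_monomial K F).
    apply: eq_bigr => F _; rewrite /on_faces /bd -big_distrl /=; congr (_ * _).
    case: ifP => _; last by rewrite big1.
    apply: eq_big => v; first by rewrite inE.
    rewrite setU0 /sg (_ : [set _ in _ | _] = set0) ?cards0 ?expr0 ?mul1r //.
    by apply/setP=> x; rewrite !inE.
  rewrite exchange_big /=; apply: eq_bigr => v _.
  rewrite (bigID (fun F => v \in F)) /= addrC.
  rewrite [X in _ + X](reindex_onto (fun F => v |: F) (fun F => F :\ v)) /=; last first.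
    by move=> F vF; rewrite setD1K.
  rewrite [X in _ + X](eq_bigl (fun F => v \notin F)); last first.
    move=> F; rewrite setU11 /=; apply/eqP/idP=> [<-|vF]; last by rewrite setU1K.
    by rewrite !inE eqxx.
  rewrite -big_split; apply: eq_bigr => F vF /=.
  rewrite /act setU11 (negPf vF) setU1K // mono_setU //.
  have [FD|FD] := boolP (F \in D); last first.
    rewrite !hF // (_ : (v |: F \in D) = false) ?mul0r ?addr0 //.
    by apply: contraNF FD => /dD; apply; apply: subsetUr.
  by case: (_ \in D); rewrite ?mulr0n ?mulr1n; ring.
apply: (ideal_sum gI) => v; rewrite big_mkcond; apply: (ideal_sum gI) => F.
case: ifP => vF; last exact: (ideal0 gI).
have [FvY|FvY] := boolP ((F, [set v]) \in cells Y D 1); last first.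
  by rewrite ch // !mul0r; exact: (ideal0 gI).
have [vFD|vFD] := boolP (v |: F \in D); first by rewrite subrr mulr0 mul0r; exact: (ideal0 gI).
apply: mono_in_ideal => //; move: FvY; rewrite in_cells sub1set inE subUset sub1set.
by case/and3P=> /DY -> /andP[_ ->].
Qed.

(** By descending induction on the least cardinality t of the faces F on which f
is nonzero. For such F no term comes from smaller faces, so f F is a cycle of
the Koszul complex on the variables of Y outside F, hence a boundary; removing
it raises t. In homological degree 0 what has to be excluded is a monomial of
f F involving no variable of Y outside F: its product with x^F has support F
within Y, so it does not lie in the ideal, and no other face can cancel it. *)
Lemma exact_bd k f : cell_chain Y D k f -> bd_cycle k f ->
  exists2 h, cell_chain Y D k.+1 h & forall F S, F \in D -> f F S = bd X h F S.
Proof.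
move=> cf zf.
suff /(_ n.+1 0%N) H : forall d t f, (n < t + d)%N -> cell_chain Y D k f -> bd_cycle k f ->
    (forall F S, (#|F| < t)%N -> f F S = 0) ->
  exists2 h, cell_chain Y D k.+1 h & forall F S, F \in D -> f F S = bd X h F S.
  by apply: H.
elim=> [|d IHd] t {}f td {}cf {}zf f0.
  exists (fun _ _ => 0) => // F S FD; rewrite f0.
    by rewrite /bd big1 // => v _; rewrite /act mulr0 if_same mulr0.
  by rewrite addn0 in td; rewrite (leq_ltn_trans _ td) // -[X in (_ <= X)%N]card_ord max_card.
have step F : exists g : V -> R, F \in D -> #|F| = t ->
    koszul_chain (Y :\: F) k.+1 g /\ forall S, f F S = koszul (Y :\: F) g S.
  have [FD|FD] := boolP (F \in D); last by exists (fun=> 0).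
  have [Ft|Ft] := eqVneq #|F| t; last by exists (fun=> 0) => _ /eqP; rewrite (negPf Ft).
  have cF : koszul_chain (Y :\: F) k (f F).
    by move=> S nS; rewrite cf // in_cells FD.
  have [||g cg gE] := koszul_exact cF.
  - move=> S; clear IHd; case: k cf zf cF => [|k] cf' zf' cF.
      rewrite /koszul big1 // => v /andP[_ vS]; rewrite cf' ?mulr0 //.
      by rewrite in_cells cardsU1 vS !andbF.
    have := zf' F S FD; rewrite /bd => e; apply: oppr_inj; rewrite oppr0 -[RHS]e.
    rewrite /koszul -sumrN big_mkcond [RHS]big_mkcond; apply: eq_bigr => v _ /=.
    rewrite /act inE; case: (boolP (v \in S)) => vS; rewrite ?andbF //= andbT.
    have [vF|vF] := boolP (v \in F) => /=.
      by rewrite f0 ?mulr0 // -Ft; apply: proper_card; apply: properD1.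
    have [vY|vY] := boolP (v \in Y); first by rewrite !(mulrN, mulNr).
    rewrite cf' ?mulr0 // in_cells subUset sub1set inE (negPf vY) andbF.
    by rewrite !andbF.
  - move=> m mV; clear IHd; case: k cf zf cF => [|k] cf' zf' cF; last first.
      by rewrite cF ?mcoeff0 // cards0 andbF.
    apply/eqP; apply: contraT => ne.
    have := (SR_idealP _ _ dD).1 zf' (m + indic F)%MM.
    have -> : supp (m + indic F)%MM :&: Y = F.
      apply/setP=> x; rewrite !inE mnmDE mnmE.
      have [xF|xF] := boolP (x \in F); first by rewrite addn1 (subsetP (DY FD)).
      apply/negP=> /andP[+ xY]; rewrite addn0 mV // inE xF //.
    rewrite FD /= => H; apply: H; rewrite /augf raddf_sum (bigD1 F) //= big1 ?addr0.
      by rewrite mcoeff_mul_monomial -indic_le lem_addl addmK.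
    move=> F' F'F; rewrite mcoeff_mul_monomial; case: ifP => // F's.
    have [F'D|F'D] := boolP (F' \in D); last by rewrite cf' ?mcoeff0 // in_cells (negPf F'D).
    rewrite f0 ?mcoeff0 // -Ft; apply: proper_card; rewrite properEneq F'F.
    apply/subsetP=> x xF'; have := subsetP F's x xF'; rewrite inE mnmDE mnmE.
    have [//|xF] := boolP (x \in F); rewrite addn0 mV // inE xF.
    exact: (subsetP (DY F'D)).
  by exists g => _ _.
have [g gE] := choice step.
(* The sign is that of the term - x_v in the differential. *)
pose h F S := if (F \in D) && (#|F| == t) then - g F S else 0.
have ch : cell_chain Y D k.+1 h.
  move=> F S; rewrite in_cells /h; case: (boolP (F \in D)) => //= FD; case: (#|F| =P t) => // Ft nb.
  by have [-> //] := gE F FD Ft; rewrite oppr0.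
have bdh F S : F \in D -> (#|F| <= t)%N -> bd X h F S = f F S.
  move=> FD; rewrite leq_eqVlt => /orP[/eqP Ft|Ft]; last first.
    rewrite f0 // /bd big1 // => v _; rewrite /act /h.
    rewrite (ltn_eqF Ft) andbF mulr0 ltn_eqF ?andbF ?if_same ?mulr0 //.
    by rewrite (leq_ltn_trans _ Ft) // subset_leq_card // subD1set.
  have [cg ->] := gE F FD Ft; rewrite /bd /koszul big_mkcond [RHS]big_mkcond.
  apply: eq_bigr => v _ /=; rewrite inE; case: (boolP (v \in S)) => vS; rewrite ?andbF //= andbT.
  rewrite /act /h; have [vF|vF] := boolP (v \in F) => /=.
    by rewrite (ltn_eqF (_ : #|F :\ v| < t)%N) ?andbF ?mulr0 // -Ft proper_card // properD1.
  rewrite FD Ft eqxx /=; have [vY|vY] := boolP (v \in Y); first by rewrite !(mulrN, mulNr, opprK).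
  by rewrite cg ?oppr0 ?mulr0 // subUset sub1set inE (negPf vY) andbF.
have [||||h' ch' h'E] := IHd t.+1 (fun F S => f F S - on_faces D (bd X h) F S).
- by rewrite addSnnS.
- by move=> F S nb; rewrite cf // (cell_chain_bd X ch) // subrr.
- have zh := bd_is_cycle ch; clear IHd step gE bdh; case: k cf zf ch zh => [|k] _ zf' _ zh /=.
    by rewrite augfB; apply: idealB => //; apply: graded_SR_ideal.
  by move=> F S FD; rewrite bdB zf' // zh // subrr.
- move=> F S; rewrite ltnS => Ft; have [FD|FD] := boolP (F \in D).
    by rewrite /on_faces FD bdh // subrr.
  by rewrite /on_faces (negPf FD) cf ?subrr // in_cells (negPf FD).
exists (fun F S => h' F S + h F S) => [F S nb|F S FD]; first by rewrite ch' // ch // addr0.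
by rewrite bdD -h'E // /on_faces FD subrK.
Qed.

Lemma homD d (p q : R) : homogeneous_of_degree d p -> homogeneous_of_degree d q ->
  homogeneous_of_degree d (p + q).
Proof. by move=> hp hq; rewrite -(hpart_id hp) -(hpart_id hq) -raddfD; apply: hom_hpart. Qed.

Lemma hom0 d : homogeneous_of_degree d (0 : R).
Proof. by rewrite -(raddf0 (hpart (K := K) (n := n) d)); apply: hom_hpart. Qed.

Lemma homN d (p : R) : homogeneous_of_degree d p -> homogeneous_of_degree d (- p).
Proof. by move=> hp; rewrite -(hpart_id hp) -raddfN; apply: hom_hpart. Qed.

Lemma hom_sg d v S (p : R) : homogeneous_of_degree d p -> homogeneous_of_degree d (sg v S * p).
Proof.
by move=> hp; rewrite /sg -signr_odd mulr_sign; case: ifP => // _; apply: homN.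
Qed.

Lemma homX (m : 'X_{1..n}) : homogeneous_of_degree (mdeg m)%:Z ('X_[m] : R).
Proof. by move=> m'; rewrite msuppX inE => /eqP ->. Qed.

Lemma mdeg_indic F : mdeg (indic F) = #|F|.
Proof.
by rewrite mdegE -sum1_card [RHS]big_mkcond; apply: eq_bigr => i _; rewrite mnmE; case: (i \in F).
Qed.

Definition cdeg i (a : 'I_#|cells Y D i|) : int :=
  (#|(enum_val a).1| + #|(enum_val a).2|)%N%:Z.

Lemma cell_disjoint i x v : x \in cells Y D i -> v \in x.2 -> v \notin x.1.
Proof.
by case: x => F S; rewrite in_cells /= => /and3P[_ /subsetP SY _] /SY; rewrite inE => /andP[].
Qed.

Lemma dmx_homogeneous i (a : 'I_#|cells Y D i.+1|) (b : 'I_#|cells Y D i|) :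
  homogeneous_of_degree (cdeg a - cdeg b) (dmx Y D X i a b).
Proof.
rewrite mxE /cell_entry /cdeg; have := @cell_disjoint _ (enum_val a) _ (enum_valP a).
have := enum_valP a; have := enum_valP b.
case: (enum_val a) (enum_val b) => [F S] [F' S'] /=; rewrite !in_cells.
move=> /and3P[_ _ /eqP S'i] /and3P[_ _ /eqP Si] dFS.
apply: big_ind => [||v /andP[vS _]]; [exact: hom0 | exact: homD |].
apply: hom_sg; rewrite Si S'i; have [->|] := eqVneq F' (v |: F).
  have -> : (v |: F == F) = false.
    by apply: contraNF (dFS v vS) => /eqP <-; rewrite setU11.
  rewrite mulr0 subr0 cardsU1 dFS //.
  rewrite (_ : _ - _ = (mdeg (0%MM : 'X_{1..n}))%:Z); last first.
    by rewrite mdeg0 /=; lia.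
  by rewrite -[_%:R]mpolyX0; apply: homX.
move=> _; rewrite sub0r; case: (F' =P F) => [->|_]; last by rewrite mulr0 oppr0; apply: hom0.
rewrite mulr1; apply: homN.
rewrite (_ : _ - _ = (mdeg (U_(v)%MM : 'X_{1..n}))%:Z); last by rewrite mdeg1; lia.
exact: homX.
Qed.

Definition augc : 'cV[R]_#|cells Y D 0| := \col_a set_monomial K (enum_val a).1.

Lemma mul_augc (u : 'rV[R]_#|cells Y D 0|) : (u *m augc) 0 0 = augf (fcoords u).
Proof.
transitivity (\sum_x coords u x * set_monomial K x.1).
  rewrite (_ : augc = \matrix_(a, b) set_monomial K (enum_val a).1).
    exact: (mulmx_coords u (fun x _ => set_monomial K x.1)).
  by apply/matrixP=> a b; rewrite !mxE.
rewrite (eq_bigr (fun x => fcoords u x.1 x.2 * set_monomial K x.1)) => [|[F S] //].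
rewrite -(pair_bigA _ (fun F S => fcoords u F S * set_monomial K F)) /=.
apply: eq_bigr => F _; rewrite (bigD1 set0) //= [X in _ + X]big1 ?addr0 // => S S0.
by rewrite cell_chain_fcoords ?mul0r // in_cells cards_eq0 (negPf S0) !andbF.
Qed.

Lemma augc_homogeneous a : homogeneous_of_degree (cdeg a) (augc a 0).
Proof.
rewrite mxE set_monomialE /cdeg; have := enum_valP a.
case: (enum_val a) => F S; rewrite in_cells => /and3P[_ _ /eqP ->] /=.
by rewrite addn0 -mdeg_indic; apply: homX.
Qed.

Lemma augc_surjective (p : R) : exists u : 'rV[R]_#|cells Y D 0|, I (p - (u *m augc) 0 0).
Proof.
have [D0|D0] := boolP (set0 \in D).
  have c0 : (set0 : V, set0 : V) \in cells Y D 0 by rewrite in_cells D0 sub0set cards0.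
  exists (p *: delta_mx 0 (enum_rank_in c0 (set0, set0))).
  rewrite -scalemxAl -rowE !mxE enum_rankK_in //= /set_monomial big_set0 mulr1 subrr.
  exact: (ideal0 (graded_SR_ideal K Y dD)).
exists 0; rewrite mul0mx mxE subr0; apply/SR_idealP => // m _.
by apply: contra D0 => /dD; apply; apply: sub0set.
Qed.

Lemma cells_exact i (u : 'rV[R]_#|cells Y D i|) :
  bd_cycle i (fcoords u) -> exists w, u = w *m dmx Y D X i.
Proof.
move=> zu; have [h ch hE] := exact_bd (cell_chain_fcoords u) zu.
exists (fvec Y D i.+1 h); apply: fcoordsP => F S FD.
rewrite fcoords_mul /on_faces FD hE //; apply: eq_bigr => v _; congr (_ * _).
by rewrite /act !fcoords_fvec.
Qed.

Lemma augc_exact (u : 'rV[R]_#|cells Y D 0|) :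
  I ((u *m augc) 0 0) <-> exists w : 'rV[R]_#|cells Y D 1|, u = w *m dmx Y D X 0.
Proof.
rewrite mul_augc; split=> [zu|[w ->]]; first exact: (@cells_exact 0).
have := bd_is_cycle (cell_chain_fcoords w); congr I; apply: eq_bigr => F _.
by rewrite fcoords_mul.
Qed.

Lemma dmx_exact i (u : 'rV[R]_#|cells Y D i.+1|) :
  u *m dmx Y D X i = 0 <-> exists w : 'rV[R]_#|cells Y D i.+2|, u = w *m dmx Y D X i.+1.
Proof.
split=> [zu|[w ->]]; last exact: dmx_dmx.
apply: cells_exact => F S FD; have := fcoords_mul X u F S.
rewrite zu /on_faces FD => <-; rewrite /fcoords /coords big1 // => a _.
by rewrite mxE if_same.
Qed.

Definition face_resolution : graded_free_resolution I :=
  @GradedFreeResolution K n I (fun i => #|cells Y D i|) cdeg augc (dmx Y D X)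
    augc_homogeneous dmx_homogeneous augc_surjective augc_exact dmx_exact.

Local Notation Z := (fun _ : 'I_n => 0 : K).
Implicit Types (G W : V) (z : V -> V -> K).

Lemma diffK_face_resolution i : diffK face_resolution i = dmx Y D Z i.
Proof.
apply/matrixP=> a b; rewrite !mxE raddf_sum; apply: eq_bigr => v _ /=.
rewrite /sg !(rmorphM, rmorphB, rmorph_nat, rmorphXn, rmorphN1) /=; congr (_ * (_ - _ * _)).
by rewrite mcoeffX mnm1_eq0.
Qed.

(** With the union W of F and S fixed, S is determined by F and the reduced
differential is the coboundary of cochains in F, up to rescaling. *)
Lemma bd_cochain W G z : G \subset W ->
  bd Z z G (W :\: G) = twist K W G * cob (fun F => twist K W F * z F (W :\: F)) G.
Proof.
move=> GW; rewrite cob_twist mulrA twist_sq mul1r /bd big_mkcond [RHS]big_mkcond.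
apply: eq_bigr => v _; rewrite inE /act; have [vG|vG] := boolP (v \in G) => /=; last first.
  by rewrite oppr0 mul0r mulr0 if_same.
have -> : v |: W :\: G = W :\: (G :\ v).
  apply/setP=> x; rewrite !inE; case: (eqVneq x v) => [->|] //=.
  by rewrite (subsetP GW) // orbC.
have -> : sg v W = sg v G * sg v (W :\: G) :> K.
  by rewrite -sgU ?setU_setD // -setI_eq0 setIDA setD_eq0 subsetIl.
by rewrite [sg v G * _ * sg v G]mulrAC sg_sq mul1r.
Qed.

Lemma bd_union z F S : bd Z z F S = bd Z (fun F' S' => if F' :|: S' == F :|: S then z F' S' else 0) F S.
Proof.
apply: eq_bigr => v _; rewrite /act; case: (boolP (v \in F)) => vF; last by rewrite /= oppr0 !mul0r.
by rewrite setUA -[F :\ v :|: [set v]]setUC setD1K // eqxx.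
Qed.

End Resolution.

(** * Hochster's formula *)

Section Hochster.
Variables (K : fieldType) (n : nat) (Y : {set 'I_n}) (D : {set {set 'I_n}}).
Hypotheses (dD : down_closed D) (DY : faces_in Y D).
Local Notation V := {set 'I_n}.
Local Notation I := (SR_ideal (K := K) Y D).
Local Notation Z := (fun _ : 'I_n => 0 : K).
Local Notation Fres := (face_resolution K dD DY).
Implicit Types (F S G W : V) (v : 'I_n) (z h : V -> V -> K).

Lemma cells_in_restr i F W : F \in restr D W -> W \subset Y -> #|W| = (#|F| + i)%N ->
  (F, W :\: F) \in cells Y D i.
Proof.
rewrite inE => /andP[FD FW] WY Wc; rewrite in_cells FD setSD //=.
by rewrite cardsDS // Wc addKn.
Qed.

Lemma cell_union i F S : (F, S) \in cells Y D i ->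
  [/\ F :|: S \subset Y, S = (F :|: S) :\: F & #|F :|: S| = (#|F| + i)%N].
Proof.
rewrite in_cells subsetD => /and3P[FD /andP[SY SF] /eqP <-].
split; first by rewrite subUset DY.
  by rewrite setDUl setDv set0U; apply/esym/setDidPl.
by apply/eqP; rewrite (leq_card_setU F S).2 disjoint_sym.
Qed.

Lemma cdegE i (a : 'I_#|cells Y D i|) F S : enum_val a = (F, S) ->
  cdeg a = #|F :|: S|%:Z.
Proof.
rewrite /cdeg => e; have := enum_valP a; rewrite e => FS.
have [_ _ ->] := cell_union FS; congr (_ + _)%N%:Z.
by move: FS; rewrite in_cells => /and3P[_ _ /eqP].
Qed.

Lemma tor_cycleP i (z : 'rV[K]_#|cells Y D i|) :
  tor_cycle (F := Fres) z <->
  forall F S, F \in D -> [disjoint F & S] -> bd Z (fcoords z) F S = 0.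
Proof.
case: i z => [|i] z /=.
  split=> // _ F S _ _; rewrite /bd big1 // => v vS.
  have zS F' : fcoords z F' (v |: S) = 0.
    by apply: cell_chain_fcoords; rewrite in_cells cardsU1 vS !andbF.
  by rewrite /act !zS mulr0 if_same mulr0.
rewrite diffK_face_resolution; split=> [z0 F S FD _|z0].
  have := fcoords_mul Z z F S; rewrite z0 /on_faces FD => <-.
  by rewrite /fcoords /coords big1 // => a _; rewrite mxE if_same.
apply: fcoordsP => F S FD; rewrite [RHS](_ : _ = 0).
  have [FS|/cell_chain_fcoords-> //] := boolP ((F, S) \in cells Y D i).
  rewrite fcoords_mul /on_faces FD z0 //.
  by move: FS; rewrite in_cells subsetD disjoint_sym => /and3P[_ /andP[]].
by rewrite /fcoords /coords big1 // => a _; rewrite mxE if_same.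
Qed.

Lemma bd_cochain_eq W F S (c : V -> K) z : S = W :\: F -> F \subset W ->
  (forall v, v \in F -> let F' := F :\ v in z F' (W :\: F') = twist K W F' * c F') ->
  bd Z z F S = twist K W F * cob c F.
Proof.
move=> -> FW zE; rewrite bd_cochain //; congr (_ * _); apply: eq_cob => v vF.
by rewrite zE // mulrA twist_sq mul1r.
Qed.

Lemma bd_eq0 z F S : (forall F' S', F' :|: S' = F :|: S -> z F' S' = 0) -> bd Z z F S = 0.
Proof.
move=> z0; rewrite bd_union /bd big1 // => v _; rewrite /act.
have z0' F' S' : (if F' :|: S' == F :|: S then z F' S' else 0) = 0.
  by case: eqP => // /z0.
by rewrite !z0' mulr0 if_same mulr0.
Qed.

(** A cocycle of D_W, placed on the cells with union W, is a cycle. *)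
Lemma tor_of_hochster i p : hochster K Y D i p -> tor_nonzero Fres i (p + i)%N%:Z.
Proof.
move=> [W [WY Wc nac]]; apply: contrapT => tor0; apply: nac => c dc cc.
pose z F S := if ((F, S) \in cells Y D i) && (F :|: S == W) then twist K W F * c F else 0.
have cz : cell_chain Y D i z by move=> F S /negPf FS; rewrite /z FS.
have zW F : F \subset W -> F \in D -> z F (W :\: F) = twist K W F * c F.
  move=> FW FD; rewrite /z setU_setD // eqxx andbT.
  have [Fp|/eqP/dc ->] := #|F| =P p; last by rewrite mulr0 if_same.
  by rewrite cells_in_restr ?inE ?FD // Wc Fp.
have [w zw] : exists w : 'rV[K]_#|cells Y D i.+1|, fvec Y D i z = w *m dmx Y D Z i.
  apply: contrapT => nb; apply: tor0; exists (fvec Y D i z); split.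
  - move=> a; rewrite mxE /z; case aE: (enum_val a) => [F S] /=.
    case: andP => [[_ /eqP FSW]|_]; last by rewrite eqxx.
    by move=> _; rewrite -[LHS]/(cdeg a) (cdegE aE) FSW Wc.
  - apply/tor_cycleP => F S FD FS.
    rewrite (eq_bd dD Z S FD (h := z)) => [|F' S' _]; last exact: fcoords_fvec.
    have [FSW|FSW] := eqVneq (F :|: S) W; last first.
      apply: bd_eq0 => F' S' e; rewrite /z e (negPf FSW) andbF //.
    have SE : S = W :\: F.
      by rewrite -FSW setDUl setDv set0U; apply/esym/setDidPl; rewrite disjoint_sym.
    have FW : F \subset W by rewrite -FSW subsetUl.
    rewrite (@bd_cochain_eq W F S c) // ?cc ?mulr0 ?inE ?FD // => v vF.
    by apply: zW; [exact: subset_trans (subD1set _ _) FW | exact: dD (subD1set _ _)].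
  - case=> w zw; apply: nb; exists w; rewrite zw; congr (_ *m _).
    exact: diffK_face_resolution.
pose b F := twist K W F * fcoords w F (W :\: F).
exists (pred_part p b) => G GW; rewrite cob_pred_part; case: eqP => [Gp|/eqP/dc //].
move: (GW); rewrite inE => /andP[GD sGW].
have := fcoords_mul Z w G (W :\: G); rewrite -zw /on_faces GD fcoords_fvec // zW //.
rewrite (@bd_cochain_eq W G _ b) // => [|v _]; last by rewrite /b mulrA twist_sq mul1r.
by move=> /(congr1 ( *%R (twist K W G))); rewrite !mulrA twist_sq !mul1r.
Qed.

(** A cycle z in one internal degree is a family of cocycles, one for each W with
p + i elements; if all of them were coboundaries, so would be z. *)
Lemma hochster_of_tor i j : tor_nonzero Fres i j ->
  exists2 p, j = (p + i)%N%:Z & hochster K Y D i p.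
Proof.
move=> [z [zj /tor_cycleP zc znb]].
have [a za] : exists a, z 0 a != 0.
  apply: contrapT => z0; apply: znb; exists 0; rewrite mul0mx; apply/rowP=> a.
  by rewrite mxE; apply/eqP; apply: contra_notT z0 => za; exists a.
case aE: (enum_val a) => [F0 S0]; have aF := cdegE aE.
pose p := #|F0|; have jp : j = (p + i)%N%:Z.
  by rewrite -(zj a za) -[LHS]/(cdeg a) aF; have := enum_valP a; rewrite aE => /cell_union[_ _ ->].
exists p => //; apply: contrapT => nh; apply: znb.
have cz := cell_chain_fcoords z.
have zdeg F S : fcoords z F S != 0 -> #|F :|: S| = (p + i)%N.
  move=> ne; have FS : (F, S) \in cells Y D i by apply: contraNT ne => /cz ->.
  have := zj (enum_rank_in FS (F, S)); rewrite -coords_val enum_rankK_in // => /(_ ne).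
  by rewrite -[LHS]/(cdeg (enum_rank_in FS (F, S))) (cdegE (enum_rankK_in FS FS)) jp => -[].
pose c W F := if F \subset W then twist K W F * fcoords z F (W :\: F) else 0.
(* The part of z on the cells with union W, as a cochain of D_W. *)
have step W : exists b : V -> K, W \subset Y -> #|W| = (p + i)%N ->
    forall F, F \in restr D W -> c W F = cob b F.
  have [[WY Wc]|nW] := pselect (W \subset Y /\ #|W| = (p + i)%N); last first.
    by exists (fun=> 0) => WY Wc; case: nW.
  have acW : acyclic_at K (restr D W) p by apply: contrapT => nac; apply: nh; exists W.
  have [||b bE] := acW (c W); last by exists b.
  - move=> F; rewrite /c; case: ifP => // FW Fp; rewrite cz ?mulr0 //.
    rewrite in_cells cardsDS // Wc; apply: contra Fp => /and3P[_ _]; rewrite -Wc.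
    by have := subset_leq_card FW; move=> h /eqP; lia.
  - move=> G; rewrite inE => /andP[GD GW].
    have dG : [disjoint G & W :\: G] by rewrite -setI_eq0 setIDA setD_eq0 subsetIl.
    have := zc G (W :\: G) GD dG; rewrite (@bd_cochain_eq W G _ (c W)) //; last first.
      by move=> v _ F'; rewrite /c (subset_trans (subD1set _ _) GW) mulrA twist_sq mul1r.
    by move=> /(congr1 ( *%R (twist K W G))); rewrite mulrA twist_sq mul1r mulr0.
have [b bE] := choice step.
pose h F S := if ((F, S) \in cells Y D i.+1) && (#|F :|: S| == (p + i)%N)
  then twist K (F :|: S) F * b (F :|: S) F else 0.
have ch : cell_chain Y D i.+1 h by move=> F S /negPf FS; rewrite /h FS.
exists (fvec Y D i.+1 h); rewrite diffK_face_resolution; apply: fcoordsP => F S FD.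
rewrite fcoords_mul /on_faces FD (eq_bd dD Z S FD (h := h)) => [|F' S' _]; last exact: fcoords_fvec.
have [FS|FS] := boolP ((F, S) \in cells Y D i); last first.
  by rewrite cz //; have := cell_chain_bd Z ch FS; rewrite /on_faces FD => ->.
have [FSY SE FSc] := cell_union FS.
have [Wc|Wc] := eqVneq #|F :|: S| (p + i)%N; last first.
  rewrite bd_eq0 => [|F' S' e]; last by rewrite /h e (negPf Wc) andbF.
  by apply/eqP; apply: contraNT Wc => /zdeg ->.
have FW : F \subset F :|: S := subsetUl _ _.
have := bE _ FSY Wc F; rewrite inE FD FW /c FW -SE => /(_ isT) cE.
rewrite (@bd_cochain_eq (F :|: S) F S (b (F :|: S))) // => [|v vF].
  by rewrite -cE mulrA twist_sq mul1r.
have F'F := subD1set F v; have F'W := subset_trans F'F FW.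
rewrite /h setU_setD // Wc eqxx andbT ifT // in_cells (dD FD F'F) setSD //=.
by rewrite cardsDS // FSc (cardsD1 v F) vF add1n addSnnS addKn.
Qed.

End Hochster.

(** * Maxima of sets of integers *)

Section Maxima.
Implicit Types (S T : int -> Prop) (m : extended int) (c z : int).

Lemma is_max_unique S m m' : is_max S m -> is_max S m' -> m' = m.
Proof.
case: m m' => [z||] [z'||] //=.
- by move=> [Sz zub] [Sz' z'ub]; congr EFin; apply: le_anti; rewrite zub // z'ub.
- by move=> [Sz _] /(_ z Sz).
- by move=> h [/h].
Qed.

Lemma max_ofE S m : is_max S m -> max_of S = m.
Proof.
by move=> Sm; apply: classical_sets.xget_unique => // m'; apply: is_max_unique.
Qed.

Definition nat_bounded S := exists N : nat, forall z, S z -> exists2 k, z = Posz k & (k <= N)%N.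

Lemma is_max_max_of S : nat_bounded S -> is_max S (max_of S).
Proof.
move=> [N SN]; suff [m Sm] : exists m, is_max S m by rewrite (max_ofE Sm).
have [[k0 Sk0]|noS] := pselect (exists k : nat, S (Posz k)); last first.
  by exists (ENInf _) => z Sz; apply: noS; have [k zk _] := SN z Sz; exists k; rewrite -zk.
have exS : exists k, `[< S (Posz k) >] by exists k0; apply/asboolP.
have ubS k : `[< S (Posz k) >] -> (k <= N)%N.
  by move=> /asboolP /SN[_ [<-]].
case: (ex_maxnP exS ubS) => k /asboolP Sk kmax; exists (EFin (Posz k)); split=> // z Sz.
have [l zl _] := SN z Sz; rewrite zl lez_nat; apply: kmax; apply/asboolP.
by rewrite -zl.
Qed.

Definition cofinal S T := forall z, S z -> exists2 z', T z' & z <= z'.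

Lemma is_max_cofinal S T m : cofinal S T -> cofinal T S -> is_max S m -> is_max T m.
Proof.
move=> ST TS; case: m => [z||] //= => [[Sz zub]|noS]; last first.
  by move=> z /TS[z' /noS].
have Tub y : T y -> y <= z by move=> /TS[y' /zub le /le_trans]; apply.
split=> //; have [z' Tz' zz'] := ST z Sz.
by have <- : z' = z by apply: le_anti; rewrite zz' Tub.
Qed.

Lemma max_of_cofinal S T : nat_bounded S -> cofinal S T -> cofinal T S -> max_of S = max_of T.
Proof.
move=> /is_max_max_of Sm ST TS; apply/esym/max_ofE; exact: is_max_cofinal Sm.
Qed.

Lemma max_of_union S T : nat_bounded S -> nat_bounded T ->
  max_of (fun z => S z \/ T z) = maxe (max_of S) (max_of T).
Proof.
move=> /is_max_max_of Sm /is_max_max_of Tm; apply: max_ofE.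
case: (max_of S) (max_of T) Sm Tm => [a||] [b||] //=.
- move=> [Sa aub] [Tb bub]; rewrite -EFin_max /= maxEle; case: leP => [ab|/ltW ba].
    by split; [right | move=> y [/aub /le_trans->|/bub]].
  by split; [left | move=> y [/aub|/bub /le_trans->]].
- move=> [Sa aub] noT; split; first by left.
  by move=> y [/aub|/noT].
- move=> noS [Tb bub]; rewrite maxNye; split; first by right.
  by move=> y [/noS|/bub].
- by move=> noS noT y [/noS|/noT].
Qed.

Lemma max_of_shift S c : nat_bounded S ->
  max_of (fun z => S (z - c)) = adde (max_of S) (EFin c).
Proof.
move=> /is_max_max_of Sm; apply: max_ofE; case: (max_of S) Sm => [a||] //=.
  move=> [Sa aub]; split; first by rewrite addrK.
  by move=> y /aub; rewrite lerBlDr.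
Qed.

End Maxima.

(** * Regularity and projective dimension *)

Section RegularityAndProjectiveDimension.
Variables (K : fieldType) (n : nat) (Y : {set 'I_n}) (D : {set {set 'I_n}}).
Hypotheses (dD : down_closed D) (DY : faces_in Y D).
Local Notation I := (SR_ideal (K := K) Y D).

Definition reg_set (z : int) := exists i p, hochster K Y D i p /\ z = p%:Z.
Definition pd_set (z : int) := exists i p, hochster K Y D i p /\ z = i%:Z.

Lemma betti_hochster i j : betti I i j <> 0%N <->
  exists2 p, j = (p + i)%N%:Z & hochster K Y D i p.
Proof.
rewrite (betti_nonzero (graded_SR_ideal K Y dD) (face_resolution K dD DY)).
split=> [/hochster_of_tor //|[p -> h]]; exact: tor_of_hochster.
Qed.

Lemma reg_quotE : reg_quot I = max_of reg_set.
Proof.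
congr max_of; apply/funext => z; apply/propext; split=> [[i [j [/betti_hochster[p -> h] ->]]]|].
  by exists i, p; split=> //; rewrite PoszD addrK.
move=> [i [p [h ->]]]; exists i, (p + i)%N%:Z; split; first by apply/betti_hochster; exists p.
by rewrite PoszD addrK.
Qed.

Lemma pd_quotE : pd_quot I = max_of pd_set.
Proof.
congr max_of; apply/funext => z; apply/propext; split=> [[i [j [/betti_hochster[p _ h] ->]]]|].
  by exists i, p.
move=> [i [p [h ->]]]; exists i, (p + i)%N%:Z; split=> //; by apply/betti_hochster; exists p.
Qed.

Lemma hochster_bound i p : hochster K Y D i p -> (p + i <= #|Y|)%N.
Proof. by move=> [W [WY <- _]]; apply: subset_leq_card. Qed.

Lemma reg_set_bounded : nat_bounded reg_set.
Proof.
exists #|Y| => z [i [p [/hochster_bound h ->]]]; exists p => //.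
exact: leq_trans (leq_addr _ _) h.
Qed.

Lemma pd_set_bounded : nat_bounded pd_set.
Proof.
exists #|Y| => z [i [p [/hochster_bound h ->]]]; exists i => //.
exact: leq_trans (leq_addl _ _) h.
Qed.

End RegularityAndProjectiveDimension.

Theorem theorem2p8 (K : fieldType) (n : nat) (k : int)
    (D : {set {set 'I_n}}) (s : {set 'I_n}) :
  -1 <= k ->
  is_complex [set: 'I_n] D ->
  decomposable k [set: 'I_n] D ->
  shedding_face [set: 'I_n] D s ->
  dimf s <= k ->
  decomposable k [set: 'I_n] (face_deletion D s) ->
  decomposable k ([set: 'I_n] :\: s) (link D s) ->
  let I := SR_ideal (K := K) [set: 'I_n] D in
  let I_del := SR_ideal (K := K) [set: 'I_n] (face_deletion D s) in
  let I_lk := SR_ideal (K := K) ([set: 'I_n] :\: s) (link D s) in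
  reg_quot I = maxe (reg_quot I_del) (adde (reg_quot I_lk) (EFin #|s|%:Z)) /\
  pd_quot I = maxe (pd_quot I_del) (pd_quot I_lk).
Proof.
move=> _ [DT dD _] _ [sD sh] _ decE _ I I_del I_lk.
have sh' : shedding D s.
  move=> t tD st v vs; have [w] := sh t tD st v vs.
  by rewrite inE => /andP[wt _]; exists w.
have dE : down_closed (face_deletion D s) by apply: closed_del.
have dL : down_closed (link D s) by apply: closed_link.
have ET : faces_in setT (face_deletion D s) by move=> G _; apply: subsetT.
have LT : faces_in (setT :\: s) (link D s).
  by move=> G; rewrite in_link subsetD subsetT => /and3P[].
have [hD hE hL] := hochster_shedding K dD DT sh' sD decE.
rewrite /I /I_del /I_lk !reg_quotE // !pd_quotE //; split.
  rewrite -max_of_shift; last exact: reg_set_bounded.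
  have bL : nat_bounded (fun z => reg_set K (setT :\: s) (link D s) (z - #|s|%:Z)).
    have [N HN] := @reg_set_bounded K n (setT :\: s) (link D s).
    exists (N + #|s|)%N => z /HN[q /eqP]; rewrite subr_eq => /eqP -> qN.
    by exists (q + #|s|)%N; rewrite ?PoszD // leq_add2r.
  rewrite -max_of_union //; last exact: reg_set_bounded.
  apply: max_of_cofinal; first exact: reg_set_bounded.
    move=> z [i [p [/hD[[i' [p' [_ pp' h]]]|[i' [q [_ pq h]]]] ->]]].
      by exists p'%:Z; [left; exists i', p' | rewrite lez_nat].
    exists (q + #|s|)%N%:Z; last by rewrite lez_nat.
    by right; exists i', q; rewrite PoszD addrK.
  move=> z [[i [p [/hE[i' [p' [_ pp' h]]] ->]]]|[i [q [/hL[i' [p' [_ qp h]]] /eqP]]]].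
    by exists p'%:Z; [exists i', p' | rewrite lez_nat].
  rewrite subr_eq => /eqP ->; exists p'%:Z; first by exists i', p'.
  by rewrite -PoszD lez_nat.
rewrite -max_of_union; [|exact: pd_set_bounded..].
apply: max_of_cofinal; first exact: pd_set_bounded.
  move=> z [i [p [/hD[[i' [p' [ii' _ h]]]|[i' [q [ii' _ h]]]] ->]]].
    by exists i'%:Z; [left; exists i', p' | rewrite lez_nat].
  by exists i'%:Z; [right; exists i', q | rewrite lez_nat].
move=> z [[i [p [/hE[i' [p' [ii' _ h]]] ->]]]|[i [q [/hL[i' [p' [ii' _ h]]] ->]]]];
  by exists i'%:Z; [exists i', p' | rewrite lez_nat].
Qed.
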